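(* There is an absolute constant $C>0$ such that every simple graph $G$ on $n$ vertices belonging to the class $R_1$ has at most $Cn$ edges. Moreover, there are infinitely many graphs that belong to $R_1$ but do not belong to $R_0$.
   Context: All graphs are finite and simple. A bend of a polygonal arc is one of its turning points. For $i\in\{0,1,2,\dots\}$, a graph $G=(V,E)$ belongs to the class $R_i$ if it can be drawn in the plane so that the vertices are represented by distinct points, each edge is represented by a polygonal arc with at most $i$ bends joining the points representing its two endpoints, and any two arcs representing edges cross only at a right angle, and never at a bend. (A crossing of two edges is a common point of their arcs other than their common endpoints.) In particular, in $R_0$ every edge is a straight-line segment. *)

(* Defs.v *)
From HB Require Import structures.
From mathcomp Require Import all_boot all_order all_algebra.
From mathcomp Require Import reals.

Set Implicit Arguments.
Unset Strict Implicit.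
Unset Printing Implicit Defensive.

Import Order.TTheory GRing.Theory Num.Theory.
Local Open Scope ring_scope.

Record sgraph := SGraph {
  vertex : finType;
  adj : rel vertex;
  adj_sym : symmetric adj;
  adj_irrefl : irreflexive adj
}.

Definition edges (G : sgraph) : {set {set vertex G}} :=
  [set e | [exists x, exists y, adj x y && (e == [set x; y])]].

Definition isomorphic (G H : sgraph) : Prop :=
  exists f : vertex G -> vertex H,
    bijective f /\ forall x y, adj (f x) (f y) = adj x y.

Section Plane.
Variable R : realType.

Definition point : Type := (R * R)%type.

Definition segment_point (a b : point) (t : R) : point :=
  ((1 - t) * a.1 + t * b.1, (1 - t) * a.2 + t * b.2).

Definition in_segment (a b x : point) : Prop :=
  exists t : R, 0 <= t <= 1 /\ x = segment_point a b t.

Definition in_open_segment (a b x : point) : Prop :=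
  exists t : R, 0 < t < 1 /\ x = segment_point a b t.

Definition perpendicular (a b c d : point) : Prop :=
  (b.1 - a.1) * (d.1 - c.1) + (b.2 - a.2) * (d.2 - c.2) = 0.

Definition collinear (a b c : point) : Prop :=
  (b.1 - a.1) * (c.2 - a.2) - (b.2 - a.2) * (c.1 - a.1) = 0.

(* A polygonal arc is encoded by the sequence p of its corners: its two
   endpoints are the first and last entries of p, and its bends are exactly the
   other entries.  The default value of nth is never used. *)
Definition corner (p : seq point) (k : nat) : point := nth (0, 0) p k.

Definition on_side (p : seq point) (k : nat) (x : point) : Prop :=
  (k.+1 < size p)%N /\ in_segment (corner p k) (corner p k.+1) x.

Definition inside_side (p : seq point) (k : nat) (x : point) : Prop :=
  (k.+1 < size p)%N /\ in_open_segment (corner p k) (corner p k.+1) x.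

Definition on_arc (p : seq point) (x : point) : Prop :=
  exists k, on_side p k x.

(* The third clause says that the arc is simple (consecutive sides share only
   their common corner, other pairs of sides are disjoint); given that, the
   fourth says that the arc really turns at each of its bends. *)
Definition polygonal_arc (p : seq point) : Prop :=
  [/\ (1 < size p)%N,
      forall k, (k.+1 < size p)%N -> corner p k <> corner p k.+1,
      forall (j k : nat) (x : point), (j < k)%N ->
        on_side p j x -> on_side p k x -> k = j.+1 /\ x = corner p k &
      forall k, (k.+2 < size p)%N ->
        ~ collinear (corner p k) (corner p k.+1) (corner p k.+2)].

(* On a simple arc, a point inside a side is neither a bend nor an endpoint;
   so this excludes a crossing at a bend, as well as an arc running through
   the endpoint of another one. *)
Definition right_angle_crossing (p q : seq point) (x : point) : Prop :=
  exists j k : nat,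
    [/\ inside_side p j x, inside_side q k x &
        perpendicular (corner p j) (corner p j.+1)
                      (corner q k) (corner q k.+1)].

(* The class R_i.  The last clause also keeps arcs off every non-incident vertex
   of positive degree; an isolated vertex may lie on an arc, which does not
   enlarge the class since such a vertex can be moved away. *)
Definition in_class (i : nat) (G : sgraph) : Prop :=
  exists (pos : vertex G -> point) (arc : {set vertex G} -> seq point),
    [/\ injective pos,
        forall e, e \in edges G ->
          polygonal_arc (arc e) /\
          exists (u v : vertex G) (bends : seq point),
            [/\ e = [set u; v],
                arc e = pos u :: rcons bends (pos v) &
                (size bends <= i)%N] &
        forall e f, e \in edges G -> f \in edges G -> e <> f ->
          forall x, on_arc (arc e) x -> on_arc (arc f) x ->
            (exists2 w, w \in e :&: f & x = pos w) \/
            right_angle_crossing (arc e) (arc f) x].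

End Plane.

(* Main.v *)
Require Import Defs.
From mathcomp Require Import all_boot all_order all_algebra.
From mathcomp Require Import reals boolp topology normedtype.
From mathcomp Require Import lra ring zify.

(** Linear bound.  Choose orthogonal coordinates in which no side is horizontal
    or vertical and cut every edge at its bend into two halves.  Crossing halves
    are perpendicular, so their slopes have opposite signs.

    A family of non-crossing x-monotone arcs has at most 3n members: an arc
    which is neither topmost at its left end nor at its right end lies directly
    below some vertex, and a vertex lies directly above at most one arc.  For
    non-crossing hairpins, whose two halves leave their vertices towards the same
    side, a similar count of consecutive halves at the vertices gives 5n.  This
    settles the edges whose halves have slopes of the same sign.

    For the others, choose greedily a set of rising halves ("spines"), each
    crossing at least six falling halves that are not crossed by the previous
    ones.  Cut each falling half that meets a spine at its first spine and continue
    it along the spine: this gives non-crossing monotone arcs from the vertices to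
    the spines.  They form a simple graph, since two halves from one vertex cannot
    both be perpendicular to the same spine; hence there are at most
    3(n + #spines) of them, with #spines at most a sixth of their number.  After
    removing these edges, each rising half crosses at most five falling ones, so
    one edge in eleven can be kept without any crossing.

    Separation.  K(3, n) has a one-bend drawing for every n: the points
    (j, -j) are reached by a vertical segment from above and by horizontal segments
    from the left and from the right.  In a straight-line drawing each segment
    crosses at most one segment from any given vertex.  So, if n is large, there
    are two of the n vertices, p and q, that lie on the same side of each line
    through two of the three hubs and whose edges do not cross.  For hubs a, b this
    forces the triangles a p q and b p q to have opposite orientations, which is
    impossible for three hubs at once. *)

Set Implicit Arguments.
Unset Strict Implicit.
Unset Printing Implicit Defensive.

Import Order.TTheory GRing.Theory Num.Theory.
Import numFieldNormedType.Exports.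
Local Open Scope ring_scope.

(** * Families of arcs over intervals *)

(** Lets [lra] close a goal of any form from contradictory inequalities. *)
Lemma absurd_le (R : numDomainType) (P : Prop) : 1 <= 0 :> R -> P.
Proof. by rewrite ler10. Qed.

(** The charging principle behind the counts below. Choice turns [P] into a function, with values in
    [option T] so that elements outside [A] need no witness. *)
Lemma leq_card_witness (S T : finType) (A : {set S}) (B : {set T})
    (P : S -> T -> Prop) :
  (forall s, s \in A -> exists2 w, w \in B & P s w) ->
  (forall s t w, P s w -> P t w -> s = t) -> (#|A| <= #|B|)%N.
Proof.
move=> exw inj.
have [f fP] : {f : S -> option T & forall s, s \in A ->
    exists2 w, f s = Some w & w \in B /\ P s w}.
  apply: (@choice S (option T)
    (fun s o => s \in A -> exists2 w, o = Some w & w \in B /\ P s w)) => s.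
  case: (boolP (s \in A)) => [/exw[w wB Pw]|_]; last by exists None.
  by exists (Some w) => _; exists w.
case: (set_0Vmem A) => [->|[s0 s0A]]; first by rewrite cards0.
have [w0 _ _] := fP _ s0A.
have injf : {in A &, injective (fun s => odflt w0 (f s))}.
  move=> s t sA tA; have [w -> [_ Pw]] := fP _ sA.
  have [w' -> [_ Pw']] := fP _ tA => /= eww'.
  by apply: (inj _ _ w) => //; rewrite eww'.
rewrite -(card_in_imset injf) subset_leq_card //.
by apply/fintype.subsetP => _ /imsetP [s sA ->]; have [w -> []] := fP _ sA.
Qed.

Section ArcFamily.
Variables (R : realType) (T S : finType) (px py : T -> R) (vis : T -> Prop).
Variables (l : S -> T) (rx : S -> R) (F : S -> R -> R).

Definition dom s x := px (l s) <= x <= rx s.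

(** Vacuous when the two domains are disjoint, hence not an order in general; among arcs with a
    common left end, [below_acyclic] makes it one. *)
Definition below s t := forall x, dom s x -> dom t x -> F s x <= F t x.

Definition consec s s' :=
  [/\ l s' = l s, s' <> s, below s s' &
      forall t, l t = l s -> below s t -> below t s' -> t = s \/ t = s'].

(** The region is closed along [s'], so that the right end of [s'] itself can count as lying in it;
    [short_next_visible] relies on this. *)
Definition between s s' X w :=
  [/\ vis w, px (l s) < px w, px w <= X, F s (px w) < py w &
      py w <= F s' (px w)].

(** [s] is the highest arc strictly below [w]. Expressed by maximality, so that [sees_inj] follows
    from the totality of [below]. *)
Definition sees s w :=
  [/\ px (l s) < px w <= rx s, F s (px w) < py w &
      forall t, px (l t) < px w <= rx t -> F t (px w) < py w ->
        below s t -> t = s].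

Definition topmost s := forall t, l t = l s -> below s t -> t = s.

Hypothesis rx_gt : forall s, px (l s) < rx s.
Hypothesis F_l : forall s, F s (px (l s)) = py (l s).
Hypothesis vis_l : forall s, vis (l s).
Hypothesis pos_inj : forall v w, vis v -> vis w -> px v = px w -> py v = py w ->
  v = w.
Hypothesis below_total : forall s t, below s t \/ below t s.
Hypothesis vertex_off : forall s w, vis w -> px (l s) < px w < rx s ->
  F s (px w) <> py w.
Hypothesis below_acyclic : forall s t u, l s = l t -> l t = l u ->
  below s t -> below t u -> below u s -> s = t.

Lemma below_refl s : below s s. Proof. by []. Qed.

Lemma below_at s t x : dom s x -> dom t x -> F s x < F t x -> below s t.
Proof.
move=> ds dt lt; case: (below_total s t) => // /(_ x dt ds).
by rewrite leNgt lt.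
Qed.

Lemma below_anti s t : l s = l t -> below s t -> below t s -> s = t.
Proof. by move=> e st ts; apply: (below_acyclic e (erefl _) st) ts. Qed.

Lemma below_trans s t u : l s = l t -> l t = l u ->
  below s t -> below t u -> below s u.
Proof.
move=> e1 e2 st tu; case: (below_total s u) => // us.
by rewrite (below_acyclic e1 e2 st tu us).
Qed.

(** If [t] began to the left of the common foot of [s] and [s'], it would be squeezed through that
    foot; if it began at the foot, it would contradict [consec]. So it begins inside the region. *)
Lemma trap s s' t X : consec s s' -> X <= rx s -> X <= rx s' ->
  below s t -> below t s' -> t <> s -> t <> s' ->
  px (l t) < X -> px (l s) < rx t -> between s s' X (l t).
Proof.
move=> [els _ _ cons] Xs Xs' st ts' nts nts' ltX slt.
have rs := rx_gt s; have rs' := rx_gt s'; have rt := rx_gt t.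
have Fls' : F s' (px (l s)) = py (l s) by rewrite -els F_l.
case: (ltgtP (px (l s)) (px (l t))) => [lt|lt|eq].
- have ds : dom s (px (l t)) by rewrite /dom; lra.
  have ds' : dom s' (px (l t)) by rewrite /dom els; lra.
  have dt : dom t (px (l t)) by rewrite /dom; lra.
  have := st _ ds dt; have := ts' _ dt ds'; rewrite F_l => le1 le2.
  split=> //; first by lra.
  rewrite lt_neqAle le2 andbT; apply/eqP; apply: vertex_off => //.
  by lra.
- have dt : dom t (px (l s)) by rewrite /dom; lra.
  have ds : dom s (px (l s)) by rewrite /dom; lra.
  have ds' : dom s' (px (l s)) by rewrite /dom els in rs' *; lra.
  have := st _ ds dt; have := ts' _ dt ds'; rewrite F_l Fls' => le1 le2.
  case: (@vertex_off t (l s)) => //; first by lra.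
  by apply/le_anti; rewrite le1 le2.
- have dt : dom t (px (l s)) by rewrite /dom; lra.
  have ds : dom s (px (l s)) by rewrite /dom; lra.
  have ds' : dom s' (px (l s)) by rewrite /dom els in rs' *; lra.
  have := st _ ds dt; have := ts' _ dt ds'; rewrite F_l Fls' eq F_l => le1 le2.
  have elt : l t = l s.
    by apply: pos_inj => //; apply/le_anti; rewrite le1 le2.
  by case: (cons t elt st ts').
Qed.

(** The leftmost vertex [w] of the region works: an arc between [s] and [w] would, by [trap], begin
    at a vertex of the region further to the left. *)
Lemma visible s s' X : consec s s' -> X <= rx s -> X <= rx s' ->
  (exists w, between s s' X w) -> exists2 w, between s s' X w & sees s w.
Proof.
move=> cons Xs Xs' [w0 bw0].
have [w /asboolP bw min] :=
  @arg_minP _ R T w0 (fun w => `[<between s s' X w>]) px (asboolT bw0).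
exists w => //; have [els _ _ _] := cons; have [_ lw wX Fs Fs'] := bw.
split=> //; first by lra.
move=> t dtw Ft st; apply: contrapT => nts.
have ts' : below t s'.
  by apply: (@below_at _ _ (px w)); rewrite /dom ?els; lra.
have nts' : t <> s' by move=> ets; rewrite ets in Ft; lra.
have ws : px w <= rx s by lra.
have ws' : px w <= rx s' by lra.
have [tw tr] : px (l t) < px w /\ px (l s) < rx t by lra.
have [vt lt ltw Flt Flt'] := trap cons ws ws' st ts' nts nts' tw tr.
have /min : `[<between s s' X (l t)>] by apply/asboolP; split=> //; lra.
by lra.
Qed.

Lemma sees_inj s t w : sees s w -> sees t w -> s = t.
Proof.
move=> [ds Fs maxs] [dt Ft maxt]; case: (below_total s t) => le.
  by apply/esym/maxs.
by apply: maxt.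
Qed.

Lemma topmost_card : (#|[set s | `[<topmost s>]]| <= #|T|)%N.
Proof.
rewrite -cardsT.
apply: (@leq_card_witness _ _ _ _ (fun s w => topmost s /\ l s = w)).
  by move=> s; rewrite inE => /asboolP top; exists (l s).
move=> s t w [tops ls] [topt lt].
have e : l s = l t by rewrite ls.
by case: (below_total s t) => [/tops->|/topt->].
Qed.

Lemma consec_ex s : ~ topmost s -> exists s', consec s s'.
Proof.
move=> /existsNP [t0 /not_implyP [e0 /not_implyP [b0 n0]]].
pose cand t := [/\ l t = l s, below s t & t <> s].
(* The successor of [s] is the arc above it with the fewest arcs below itself. *)
pose rk t := #|[set u | `[<l u = l s /\ below u t>]]|.
have [t /asboolP [et bt nt] min] :=
  @arg_minP _ nat S t0 (fun t => `[<cand t>]) rk (asboolT (And3 e0 b0 n0)).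
exists t; split=> // u eu bu but; case: (pselect (u = s)) => [|nus]; [by left|right].
apply: contrapT => nut.
have /min : `[<cand u>] by apply/asboolP.
rewrite leEnat leqNgt => /negP; apply; apply: proper_card; apply/properP; split.
  apply/fintype.subsetP => v; rewrite !inE => /asboolP [ev bv]; apply/asboolP.
  by split=> //; apply: (@below_trans _ u); rewrite ?ev ?eu ?et.
exists t; rewrite !inE; first by apply/asboolP; split=> //; exact: below_refl.
by apply/asboolP => -[_ btu]; apply: nut; apply: below_anti; rewrite ?eu ?et.
Qed.

Lemma consec_fun s t u : consec s t -> consec s u -> t = u.
Proof.
move=> [et nt bt ct] [eu nu bu cu].
case: (below_total t u) => le.
  by case: (cu t et bt le).
by case: (ct u eu bu le).
Qed.

Lemma consec_inj s t u : consec s u -> consec t u -> s = t.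
Proof.
move=> [es ns bs cs] [et nt bt ct].
case: (below_total s t) => le.
  by case: (cs t) => //; [rewrite -et|move=> e; case: nt].
by case: (ct s) => //; [rewrite -es|move=> e; case: ns].
Qed.

End ArcFamily.

(* The arc of [e] is the graph of [F e] over the interval between its ends.  Two
   arcs may merge, as long as neither changes sides of the other. *)
Record plane_arcs (R : realType) (T E : finType) (px py : T -> R)
    (l r : E -> T) (F : E -> R -> R) : Prop := PlaneArcs {
  pa_lr : forall e, px (l e) < px (r e);
  pa_l : forall e, F e (px (l e)) = py (l e);
  pa_r : forall e, F e (px (r e)) = py (r e);
  pa_inj : forall e f v w, v = l e \/ v = r e -> w = l f \/ w = r f ->
    px v = px w -> py v = py w -> v = w;
  pa_total : forall e f, below px l (px \o r) F e f \/ below px l (px \o r) F f e;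
  pa_off : forall e f w, w = l f \/ w = r f -> px (l e) < px w < px (r e) ->
    F e (px w) <> py w;
  pa_simple : forall e f, l e = l f -> r e = r f -> e = f }.

Definition mirror (R : realType) (E : Type) (F : E -> R -> R) e x := F e (- x).

Lemma plane_arcs_mirror (R : realType) (T E : finType) (px py : T -> R)
    (l r : E -> T) (F : E -> R -> R) :
  plane_arcs px py l r F -> plane_arcs (\- px) py r l (mirror F).
Proof.
case=> lr Fl Fr inj tot off sim.
have belowE e f : below px l (px \o r) F e f ->
    below (\- px) r ((\- px) \o l) (mirror F) e f.
  by move=> b x; rewrite /dom /mirror /= => de df; apply: b; rewrite /dom /=; lra.
split; rewrite /mirror => //=.
- by move=> e; rewrite ltrN2.
- by move=> e; rewrite opprK.
- by move=> e; rewrite opprK.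
- by move=> e f v w /or_comm hv /or_comm hw /oppr_inj; apply: inj hv hw.
- by move=> e f; case: (tot e f) => /belowE; [left|right].
- by move=> e f w /or_comm hw lw; rewrite opprK; apply: (off _ f) => //; lra.
- by move=> e f er el; apply: sim.
Qed.

(** * Arcs with both ends at vertices *)

Section PlaneArcs.
Variables (R : realType) (T E : finType) (px py : T -> R) (l r : E -> T)
  (F : E -> R -> R).
Hypothesis pa : plane_arcs px py l r F.

Let rx := px \o r.
Let vis w := exists e, w = l e \/ w = r e.
Let le := below px l rx F.

(** Unlike in [sees], both ends of the interval are excluded, which makes the notion invariant under
    reflection. *)
Definition directly_above e w :=
  [/\ px (l e) < px w < px (r e), F e (px w) < py w &
      forall f, px (l f) < px w < px (r f) -> F f (px w) < py w ->
        le e f -> f = e].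

Let rx_gt e : px (l e) < rx e. Proof. exact: pa_lr pa _. Qed.

Let vis_inj v w : vis v -> vis w -> px v = px w -> py v = py w -> v = w.
Proof. by move=> [e he] [f hf]; apply: (pa_inj pa he hf). Qed.

Let off e w : vis w -> px (l e) < px w < px (r e) -> F e (px w) <> py w.
Proof. by move=> [f hf]; apply: (pa_off pa hf). Qed.

Let visl e : vis (l e). Proof. by exists e; left. Qed.
Let visr e : vis (r e). Proof. by exists e; right. Qed.

(** Arcs in a cycle agree as far as the shortest one reaches. Since no arc runs through a vertex, an
    arc that agrees with another at its right end also ends there, and [pa_simple] identifies the
    two. *)
Let acyclic e f g : l e = l f -> l f = l g -> le e f -> le f g -> le g e -> e = f.
Proof.
move=> ef fg lef lfg lge.
have re := pa_lr pa e; have rf := pa_lr pa f; have rg := pa_lr pa g.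
have Fe := pa_r pa e; have Ff := pa_r pa f; have Fg := pa_r pa g.
rewrite -fg -ef in rg; rewrite -ef in rf.
have eqF x : px (l e) <= x -> x <= px (r e) -> x <= px (r f) -> x <= px (r g) ->
    F e x = F f x /\ F f x = F g x.
  move=> x0 x1 x2 x3.
  have de : dom px l rx e x by rewrite /dom /rx /=; lra.
  have df : dom px l rx f x by rewrite /dom /rx /= -ef; lra.
  have dg : dom px l rx g x by rewrite /dom /rx /= -fg -ef; lra.
  by have := lef _ de df; have := lfg _ df dg; have := lge _ dg de; lra.
have same a b : l a = l e -> l b = l e -> px (r a) <= px (r b) ->
    F b (px (r a)) = F a (px (r a)) -> a = b.
  move=> la lb; rewrite (pa_r pa) le_eqVlt => /orP [/eqP eq|lt] Fb.
    apply: (pa_simple pa); first by rewrite la lb.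
    by apply: vis_inj => //; rewrite -Fb eq (pa_r pa).
  have ra := pa_lr pa a.
  by case: (@off b (r a)) => //; rewrite lb -la; lra.
have [m1|m1] := leP (px (r e)) (px (r f)).
  have [m2|m2] := leP (px (r e)) (px (r g)).
    by apply: same => //; have [] := eqF (px (r e)) => //; lra.
  have eg : g = e by apply: same => //; [rewrite -fg -ef|lra|have [] := eqF (px (r g)); lra].
  have eg' : g = f by apply: same => //; [rewrite -fg -ef|lra|have [] := eqF (px (r g)); lra].
  by rewrite -eg -eg'.
have [m2|m2] := leP (px (r f)) (px (r g)).
  by apply/esym/same => //; [lra|have [] := eqF (px (r f)); lra].
have eg : g = e by apply: same => //; [rewrite -fg -ef|lra|have [] := eqF (px (r g)); lra].
have eg' : g = f by apply: same => //; [rewrite -fg -ef|lra|have [] := eqF (px (r g)); lra].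
by rewrite -eg -eg'.
Qed.

Lemma top_left_card : (#|[set e | `[<topmost px l rx F e>]]| <= #|T|)%N.
Proof. exact: topmost_card (pa_total pa). Qed.

Lemma next_left_ex e : ~ topmost px l rx F e -> exists f, consec px l rx F e f.
Proof. exact: consec_ex (pa_total pa) acyclic _. Qed.

(** The right end of the shorter arc [f] lies on the upper boundary of the region between [e] and
    [f], so the region is not empty and [visible] applies. *)
Lemma short_next_visible e f : consec px l rx F e f -> px (r f) < px (r e) ->
  exists w, directly_above e w.
Proof.
move=> cons lt; have [elf nef lef _] := cons.
have lrf := pa_lr pa f.
have [|w [vw w1 w2 w3 _] [s1 s2 s3]] := visible rx_gt (pa_l pa) visl vis_inj
   (pa_total pa) off cons (ltW lt) (lexx _).
- exists (r f); rewrite elf in lrf; split=> //; last first.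
  + by rewrite (pa_r pa).
  + have de : dom px l rx e (px (r f)) by rewrite /dom /rx /=; lra.
    have df : dom px l rx f (px (r f)) by rewrite /dom /rx /= elf; lra.
    have := lef _ de df; rewrite (pa_r pa) => le1.
    rewrite lt_neqAle le1 andbT; apply/eqP/off => //.
    by lra.
- exists w; split => //; first by rewrite w1 /=; lra.
  move=> g dg Fg leg; apply: s3 => //; rewrite /rx /=; lra.
Qed.

End PlaneArcs.

Lemma directly_above_mirror (R : realType) (T E : finType) (px py : T -> R)
    (l r : E -> T) (F : E -> R -> R) e w :
  directly_above (\- px) py r l (mirror F) e w -> directly_above px py l r F e w.
Proof.
rewrite /directly_above /mirror /= opprK => -[lr Fe max]; split=> //; first by lra.
move=> f lrf Ff lef; apply: max => //; first by lra.
by move=> x de df; rewrite /mirror; apply: lef; move: de df; rewrite /dom /=; lra.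
Qed.

Lemma plane_arcs_card (R : realType) (T E : finType) (px py : T -> R)
    (l r : E -> T) (F : E -> R -> R) :
  plane_arcs px py l r F -> (#|E| <= 3 * #|T|)%N.
Proof.
move=> pa; have pa' := plane_arcs_mirror pa.
have topl := top_left_card pa; have topr := top_left_card pa'.
set A := [set _ | _] in topl; set B := [set _ | _] in topr.
pose C := [set e | `[<exists w, directly_above px py l r F e w>]].
have cC : (#|C| <= #|T|)%N.
  rewrite -cardsT; apply: (@leq_card_witness _ _ _ _ (directly_above px py l r F)).
    by move=> e; rewrite inE => /asboolP [w]; exists w; rewrite ?inE.
  move=> e f w [e1 e2 e3] [f1 f2 f3].
  by case: (pa_total pa e f) => [/e3->|/f3->].
have cov : [set: E] \subset A :|: B :|: C.
  apply/fintype.subsetP => e _; rewrite !inE.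
  case: asboolP => //= ntl; case: asboolP => //= ntr; apply/asboolP.
  have [f cf] := next_left_ex pa ntl; have [g cg] := next_left_ex pa' ntr.
  have [lt|gef] := ltP (px (r f)) (px (r e)); first exact: short_next_visible cf lt.
  have [lt|geg] := ltP (px (l e)) (px (l g)).
    have [w /directly_above_mirror dw] : exists w, directly_above (\- px) py r l (mirror F) e w.
      by apply: short_next_visible cg _ => //=; rewrite ltrN2.
    by exists w.
  (* In the remaining case [f] starts with [e] and passes strictly above its right end, while [g]
     ends with [e] and passes strictly above its left end. Then [f] and [g] change sides, against
     [pa_total]. *)
  have [lef nef bef _] := cf; have [leg neg beg _] := cg.
  have le := pa_lr pa e; have lf := pa_lr pa f; have lg := pa_lr pa g.
  rewrite lef in lf; rewrite leg in lg.
  have F1 : F f (px (l e)) = py (l e) by rewrite -lef (pa_l pa).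
  have F2 : F g (px (r e)) = py (r e) by rewrite -leg (pa_r pa).
  have F3 := pa_l pa e; have F4 := pa_r pa e.
  have le1 : F e (px (l e)) <= F g (px (l e)).
    by have := beg (- px (l e)); rewrite /mirror opprK; apply; rewrite /dom /= ?leg; lra.
  have le2 : F e (px (r e)) <= F f (px (r e)).
    by apply: bef; rewrite /dom /= ?lef; lra.
  have ne1 : F g (px (l e)) <> py (l e).
    move: geg; rewrite le_eqVlt => /orP [/eqP eq|lt] Fg.
      apply: neg; apply: (pa_simple pa) => //.
      apply: (pa_inj pa (e := g) (f := e)); [by left|by left|by []|].
      by rewrite -(pa_l pa) eq.
    by apply: (pa_off pa (e := g) (f := e) (w := l e)) => //; [left|rewrite leg; lra].
  have ne2 : F f (px (r e)) <> py (r e).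
    move: gef; rewrite le_eqVlt => /orP [/eqP eq|lt] Ff.
      apply: nef; apply: (pa_simple pa) => //.
      apply: (pa_inj pa (e := f) (f := e)); [by right|by right|by []|].
      by rewrite -(pa_r pa) -eq.
    by apply: (pa_off pa (e := f) (f := e) (w := r e)) => //; [right|rewrite lef; lra].
  exfalso; case: (pa_total pa f g) => [/(_ (px (r e)))|/(_ (px (l e)))];
    rewrite /dom /= lef leg => /(_ _ _) H.
    have : F f (px (r e)) <= F g (px (r e)) by apply: H; lra.
    by rewrite F2 => le3; apply: ne2; apply/le_anti; rewrite le3 -F4.
  have : F g (px (l e)) <= F f (px (l e)) by apply: H; lra.
  by rewrite F1 => le3; apply: ne1; apply/le_anti; rewrite le3 -F3.
rewrite -cardsT (leq_trans (subset_leq_card cov)) //.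
rewrite (leq_trans (leq_card_setU _ _)) // (leq_trans (leq_add (leq_card_setU _ _) cC)) //.
by rewrite !mulSn mul0n addn0 addnA leq_add2r leq_add.
Qed.

(** * Hairpins *)

(* Both halves [(e, true)] (upper) and [(e, false)] (lower) of a hairpin run to the
   right, from their feet [z] to the common abscissa [bx e] of the bend. *)
Record hairpins (R : realType) (V E : finType) (px py : V -> R)
    (z : E * bool -> V) (bx : E -> R) (F : E * bool -> R -> R) : Prop :=
  Hairpins {
  hp_lt : forall s, px (z s) < bx s.1;
  hp_l : forall s, F s (px (z s)) = py (z s);
  hp_b : forall e, F (e, true) (bx e) = F (e, false) (bx e);
  hp_up : forall e, below px z (bx \o fst) F (e, false) (e, true);
  hp_inj : forall v w, px v = px w -> py v = py w -> v = w;
  hp_total : forall s t, below px z (bx \o fst) F s t \/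
    below px z (bx \o fst) F t s;
  hp_disj : forall s t x, s <> t -> dom px z (bx \o fst) s x ->
    dom px z (bx \o fst) t x -> F s x = F t x ->
    (z s = z t /\ x = px (z s)) \/ (s.1 = t.1 /\ x = bx s.1);
  hp_loopless : forall e, z (e, true) <> z (e, false);
  hp_simple : forall e f, z (e, true) = z (f, true) ->
    z (e, false) = z (f, false) -> e = f }.

Section Hairpins.
Variables (R : realType) (V E : finType) (px py : V -> R) (z : E * bool -> V)
  (bx : E -> R) (F : E * bool -> R -> R).
Hypothesis hp : hairpins px py z bx F.

Let rx : E * bool -> R := bx \o fst.
Let vis w := exists s, w = z s.
Let le := below px z rx F.
Let bet := between px py vis z F.
Let consecutive := consec px z rx F.

Let total : forall s t, le s t \/ le t s. Proof. exact: hp_total hp. Qed.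

Let rx_gt s : px (z s) < rx s. Proof. exact: hp_lt hp _. Qed.

Let visl s : vis (z s). Proof. by exists s. Qed.

Let inj v w : vis v -> vis w -> px v = px w -> py v = py w -> v = w.
Proof. by move=> _ _; apply: hp_inj hp _ _. Qed.

Let off s w : vis w -> px (z s) < px w <= rx s -> F s (px w) <> py w.
Proof.
move=> [k ->] lw Fw; have := rx_gt k => lk.
have [ks|nks] := pselect (s = k); first by rewrite ks in lw; apply: (@absurd_le R); lra.
have ds : dom px z rx s (px (z k)) by rewrite /dom; lra.
have dk : dom px z rx k (px (z k)) by rewrite /dom; lra.
rewrite -(hp_l hp k) in Fw.
case: (hp_disj hp nks ds dk Fw) => -[e eqx].
  by move: lw; rewrite eqx ltxx.
by move: lk; rewrite eqx e ltxx.
Qed.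

Let offw s w : vis w -> px (z s) < px w < rx s -> F s (px w) <> py w.
Proof. by move=> vw lw; apply: off => //; lra. Qed.

Let half_eq s t : s.1 = t.1 -> z s = z t -> s = t.
Proof.
case: s t => [e b] [f c] /= <-; have := hp_loopless hp (e := e).
by case: b c => [] [] // h1 h2; case: h1; rewrite h2.
Qed.

(** The three halves agree where the shortest one ends. By [hp_disj] this happens only within one
    hairpin, whose halves have distinct feet. *)
Let acyclic s t u : z s = z t -> z t = z u -> le s t -> le t u -> le u s -> s = t.
Proof.
move=> st tu lst ltu lus; apply: contrapT => nst.
have rs := rx_gt s; have rt := rx_gt t; have ru := rx_gt u.
rewrite -tu -st in ru; rewrite -st in rt.
pose x := Num.min (rx s) (Num.min (rx t) (rx u)).
have [x0 [x1 [x2 x3]]] : px (z s) < x /\ x <= rx s /\ x <= rx t /\ x <= rx u.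
  rewrite !lt_min rs rt ru; split=> //; split; first by rewrite ge_min lexx.
  by split; rewrite !ge_min lexx ?orbT.
have ds : dom px z rx s x by rewrite /dom; lra.
have dt : dom px z rx t x by rewrite /dom -st; lra.
have du : dom px z rx u x by rewrite /dom -tu -st; lra.
have Fst : F s x = F t x.
  by have := lst _ ds dt; have := ltu _ dt du; have := lus _ du ds; lra.
case: (hp_disj hp nst ds dt Fst) => -[e eqx]; first by apply: (@absurd_le R); lra.
by apply: nst; apply: half_eq.
Qed.

Definition clear_next s s' :=
  consecutive s s' /\ forall w, ~ bet s s' (Num.min (rx s) (rx s')) w.

Let top := [set s | `[<topmost px z rx F s>]].
Let seeing := [set s | `[<exists w, sees px py z rx F s w>]].

Let top_card : (#|top| <= #|V|)%N. Proof. exact: topmost_card total. Qed.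

Let seeing_card : (#|seeing| <= #|V|)%N.
Proof.
rewrite -cardsT; apply: (@leq_card_witness _ _ _ _ (sees px py z rx F)).
  by move=> s; rewrite inE => /asboolP [w]; exists w; rewrite ?inE.
by move=> s t w; exact: (sees_inj total).
Qed.

Let clear_next_ex s : s \notin top -> s \notin seeing -> exists s', clear_next s s'.
Proof.
rewrite !inE => /asboolP ntop /asboolP nsee.
have [s' cs] := consec_ex total acyclic ntop.
exists s'; split=> // w bw; apply: nsee.
have [|||w' _ sw] := visible rx_gt (hp_l hp) visl inj total offw cs (X := Num.min (rx s) (rx s')).
- by rewrite ge_min lexx.
- by rewrite ge_min lexx orbT.
- by exists w.
by exists w'.
Qed.

Let consec_lt s s' x : consecutive s s' -> px (z s) < x -> x <= rx s -> x <= rx s' ->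
  F s x < F s' x.
Proof.
move=> [ez ns lss' _] x0 x1 x2.
have ds : dom px z rx s x by rewrite /dom; lra.
have ds' : dom px z rx s' x by rewrite /dom ez; lra.
rewrite lt_neqAle lss' // andbT; apply/eqP => eqF.
case: (hp_disj hp (nesym ns) ds ds' eqF) => -[e eqx]; first by apply: (@absurd_le R); lra.
by apply: ns; apply: half_eq.
Qed.

(* Nothing lies between the two halves, so the partner of the shorter one leaves
   its bend on the side away from the longer one. *)
Let clear_next_side s s' : clear_next s s' ->
  if rx s <= rx s' then s.2 else ~~ s'.2.
Proof.
case=> cs nob; have [ez ns lss' _] := cs.
have rs := rx_gt s; have rs' := rx_gt s'; rewrite ez in rs'.
case: leP => [le1|lt1].
- case: s => e [] //= in cs nob ez ns lss' rs rs' le1 *.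
  exfalso; set t := (e, true).
  have tr : rx t = rx (e, false) by [].
  have rt := rx_gt t.
  have Flt := consec_lt cs rs (lexx _) le1.
  have nts : t <> (e, false) by [].
  have nts' : t <> s'.
    by move=> ts'; move: ez; rewrite -ts' => /(hp_loopless hp).
  have lts' : le t s'.
    apply: (below_at total (x := rx t)); rewrite /dom ?ez ?tr; try lra.
    by rewrite (hp_b hp).
  have X1 : bx e <= rx (e, false) by [].
  apply: (nob (z t)); rewrite (min_idPl le1).
  by apply: (trap rx_gt (hp_l hp) visl inj offw cs) => //; apply: hp_up hp _.
- case: s' => e [] //= in cs nob ez ns lss' rs' lt1 *.
  exfalso; set t := (e, false).
  have tr : rx t = rx (e, true) by [].
  have rt := rx_gt t.
  have Flt := consec_lt cs rs' (ltW lt1) (lexx _).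
  have nts : t <> (e, true) by [].
  have nts' : t <> s.
    by move=> ts'; move: ez; rewrite -ts' => /(hp_loopless hp).
  have lst : le s t.
    apply: (below_at total (x := rx t)); rewrite /dom ?ez ?tr; try lra.
    by rewrite -(hp_b hp).
  apply: (nob (z t)); rewrite (min_idPr (ltW lt1)).
  apply: (trap rx_gt (hp_l hp) visl inj offw cs) => //; first exact: ltW.
  exact: hp_up hp _.
Qed.

(** In a clear pair [s], [s'], [clear_next_side] makes the shorter half an upper one if it is [s]
    and a lower one if it is [s']. The two sets collect the hairpins of these shorter halves. *)
Let G1 := [set e | `[<exists2 s', clear_next (e, true) s' & bx e <= rx s'>]].
Let G2 := [set e | `[<exists2 s, clear_next s (e, false) & bx e < rx s>]].

(** Counts halves: at most [#|V|] are topmost, at most [#|V|] see a vertex, and each other half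
    begins a clear pair, charged to the hairpin of its shorter half. Hence the complements of [G1]
    and [G2] have together at most [2 * #|V|] elements. *)
Let G_card : (2 * #|E| <= 2 * #|V| + #|G1| + #|G2|)%N.
Proof.
pose B1 := [set s : E * bool | s.2 && (s.1 \in G1)].
pose B2 := [set s : E * bool |
  `[<exists2 e, clear_next s (e, false) & e \in G2>]].
have c1 : (#|B1| <= #|G1|)%N.
  apply: (@leq_card_witness (E * bool)%type E _ _ (fun s e => s.2 /\ s.1 = e)).
    by move=> s; rewrite inE => /andP [s2 s1]; exists s.1.
  by move=> [e b] [f c] g [/= -> ->] [/= -> ->].
have c2 : (#|B2| <= #|G2|)%N.
  apply: (@leq_card_witness (E * bool)%type E _ _ (fun s e => clear_next s (e, false))).
    by move=> s; rewrite inE => /asboolP [e cs eG]; exists e.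
  by move=> s t e [cs _] [ct _]; apply: consec_inj total _ _ _ cs ct.
have cov : [set: E * bool] \subset top :|: seeing :|: (B1 :|: B2).
  apply/fintype.subsetP => s _; rewrite !in_setU.
  case: (boolP (s \in top)) => //= nt; case: (boolP (s \in seeing)) => //= ns.
  have [s' cs] := clear_next_ex nt ns.
  have := clear_next_side cs; case: leP => [le1 s2|lt1 s2].
    apply/orP; left; rewrite inE s2 /= inE; apply/asboolP; exists s' => //.
    by move: s2 cs; case: (s) => e b /= ->.
  apply/orP; right; rewrite inE; apply/asboolP.
  move: s2 cs lt1; case: s' => e b /= /negbTE -> cs lt1.
  by exists e => //; rewrite inE; apply/asboolP; exists s.
have := subset_leq_card cov; rewrite cardsT card_prod card_bool.
have := (leq_card_setU (top :|: seeing) (B1 :|: B2)).1.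
have := (leq_card_setU top seeing).1; have := (leq_card_setU B1 B2).1.
have := top_card; have := seeing_card; move: c1 c2.
move: #|seeing| #|top| #|V| #|B1| #|G1| #|B2| #|G2| #|E|.
move: #|B1 :|: B2| #|top :|: seeing| #|top :|: seeing :|: (B1 :|: B2)|.
clear; lia.
Qed.

(** * The pocket to the right of a bend *)

Section Pocket.
Variables (e : E) (s' t' : E * bool).
Hypotheses (ns : clear_next (e, true) s') (nt : clear_next t' (e, false)).
Hypotheses (les : bx e <= rx s') (ltt : bx e < rx t').

Let s := (e, true).
Let t := (e, false).
Let by_ := F s (bx e).
Let zs : z s' = z s. Proof. by case: ns => -[]. Qed.
Let zt : z t' = z t. Proof. by case: nt => -[]. Qed.
Let ps : px (z s) < bx e. Proof. exact: (rx_gt s). Qed.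
Let pt : px (z t) < bx e. Proof. exact: (rx_gt t). Qed.
Let s's : s' <> s. Proof. by case: ns => -[]. Qed.
Let s't' : s' <> t'.
Proof. by move=> st; move: zt; rewrite -st zs => /(hp_loopless hp). Qed.

Let bs' : by_ < F s' (bx e).
Proof. by apply: (consec_lt ns.1) => //; exact: lexx. Qed.

Let bt' : F t' (bx e) < by_.
Proof.
rewrite /by_ (hp_b hp).
by apply: (consec_lt nt.1) => //; rewrite ?zt; [exact: pt|exact: ltW].
Qed.

Let ctx : [/\ px (z s) < bx e, px (z t) < bx e, bx e <= rx s' & bx e < rx t'].
Proof. by split. Qed.

Let lt's' : le t' s'.
Proof.
have [c1 c2 c3 c4] := ctx; have hs := bs'; have ht := bt'.
by apply: (below_at total (x := bx e)); rewrite /dom ?zs ?zt; lra.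
Qed.

Let lt's'_lt x : bx e <= x -> x <= rx s' -> x <= rx t' -> s'.1 <> t'.1 ->
  F t' x < F s' x.
Proof.
have [c1 c2 c3 c4] := ctx.
move=> x0 x1 x2 nst.
have ds : dom px z rx s' x by rewrite /dom zs; lra.
have dt : dom px z rx t' x by rewrite /dom zt; lra.
rewrite lt_neqAle lt's' // andbT; apply/eqP => eqF.
case: (hp_disj hp (nesym s't') dt ds eqF) => -[h _]; last exact/nst/esym.
by move: h; rewrite zs zt => /esym/(hp_loopless hp).
Qed.

(** A half that was already present at the abscissa of the bend would pass above or below the bend,
    hence be squeezed into one of the two clear pairs [s], [s'] and [t'], [t]; but no foot lies in
    their regions. *)
Let trap2 a : le t' a -> le a s' -> a <> t' -> a <> s' -> a.1 <> e ->
  bx e <= rx a -> bx e < px (z a).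
Proof.
have [c1 c2 c3 c4] := ctx.
have hs := bs'; have ht := bt'.
move=> lta las nat nas nae ra; rewrite ltNge; apply/negP => za.
have da : dom px z rx a (bx e) by rewrite /dom; lra.
have ds : dom px z rx s (bx e) by rewrite /dom /rx /=; lra.
have dt : dom px z rx t (bx e) by rewrite /dom /rx /=; lra.
have ds' : dom px z rx s' (bx e) by rewrite /dom zs; lra.
have dt' : dom px z rx t' (bx e) by rewrite /dom zt; lra.
have nas0 : a <> s by move=> as0; apply: nae; rewrite as0.
have nat0 : a <> t by move=> as0; apply: nae; rewrite as0.
have Fa : F a (bx e) <> by_.
  move=> eqF; case: (hp_disj hp nas0 da ds eqF) => -[h1 h2] //.
  by rewrite h1 in h2; apply: (@absurd_le R); lra.
have bt : by_ = F t (bx e) by rewrite /by_ (hp_b hp).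
have [le1|lt1] := leP by_ (F a (bx e)).
  have lt1 : by_ < F a (bx e) by rewrite lt_neqAle le1 andbT eq_sym; apply/eqP.
  have lsa : le s a by apply: (below_at total ds da lt1).
  case: ns => cs /(_ (z a)); apply; rewrite (min_idPl les).
  move: za; rewrite le_eqVlt => /orP [/eqP za|za].
    split=> //; rewrite ?za //; rewrite -?za ?(hp_l hp) // za.
    + by rewrite -[X in _ < X](hp_l hp) za.
    + by rewrite -[X in X <= _](hp_l hp) za; apply: las.
  apply: (trap rx_gt (hp_l hp) visl inj offw cs) => //.
  by have := ps; rewrite /s; lra.
have lat : le a t by apply: (below_at total da dt); rewrite -bt.
case: nt => ct /(_ (z a)); apply; rewrite (min_idPr (ltW ltt)).
move: za; rewrite le_eqVlt => /orP [/eqP za|za].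
  have Faz : F a (bx e) = py (z a) by rewrite -za (hp_l hp).
  split=> //; rewrite ?za ?zt ?lexx //.
  + rewrite lt_neqAle -Faz lta // andbT; apply/eqP; rewrite Faz -za; apply: off => //.
    by rewrite zt za; lra.
  + by rewrite -Faz -bt ltW.
apply: (trap rx_gt (hp_l hp) visl inj offw ct) => //; [exact: ltW|].
by rewrite zt; lra.
Qed.

Let M := Num.min (rx s') (rx t').
Definition pocket w :=
  [/\ vis w, bx e < px w <= M, F t' (px w) < py w & py w < F s' (px w)].

Let M_le x : x <= M -> x <= rx s' /\ x <= rx t'.
Proof. by rewrite le_min => /andP. Qed.

Let in_pocket a : le t' a -> le a s' -> bx e < px (z a) <= M -> pocket (z a).
Proof.
have [c1 c2 c3 c4] := ctx.
move=> lta las /[dup] zM /andP [za /M_le [zs1 zt1]].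
have ra := rx_gt a.
have da : dom px z rx a (px (z a)) by rewrite /dom; lra.
have ds : dom px z rx s' (px (z a)) by rewrite /dom zs; lra.
have dt : dom px z rx t' (px (z a)) by rewrite /dom zt; lra.
have := lta _ dt da; have := las _ da ds; rewrite (hp_l hp) => l1 l2.
split=> //; rewrite lt_neqAle ?l1 ?l2 andbT; apply/eqP; last first.
  by apply/nesym/off => //; rewrite zs; lra.
by apply/off => //; rewrite zt; lra.
Qed.

(** Dual to [sees]: [a] is the lowest half strictly above [w]. *)
Definition first_above a w :=
  [/\ px (z a) < px w <= rx a, py w < F a (px w) &
    forall f, px (z f) < px w <= rx f -> py w < F f (px w) -> le f a -> f = a].

(** As in [visible], the leftmost vertex of the pocket works: by [trap2], a half between it and [s']
    would begin in the pocket further to the left. *)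
Lemma pocket_visible : (exists w, pocket w) -> exists w, first_above s' w.
Proof.
have [c1 c2 c3 c4] := ctx.
move=> [w0 pw0]; have [w /asboolP pw min] :=
  @arg_minP _ R V w0 (fun w => `[<pocket w>]) px (asboolT pw0).
have [vw /andP [w1 /M_le [w2 w3]] w4 w5] := pw.
exists w; split=> //; first by rewrite zs; lra.
move=> f df pf lfs; apply: contrapT => nfs.
have ltf : le t' f.
  by apply: (below_at total (x := px w)); rewrite /dom ?zt; lra.
have nft : f <> t' by move=> ft; move: pf; rewrite ft ltNge (ltW w4).
have nfe : f.1 <> e by move=> fe; rewrite /rx /= fe in df; apply: (@absurd_le R); lra.
have zf : bx e < px (z f) by apply: trap2 => //; lra.
have /min : `[<pocket (z f)>] by apply/asboolP/in_pocket => //; rewrite le_min; lra.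
by move=> h; apply: (@absurd_le R); lra.
Qed.

(** Such a hairpin would have the same two feet as [e]. *)
Let same_ends f : s' = (f, true) -> t' = (f, false) -> False.
Proof.
move=> es' et'; have fe : f = e by apply: (hp_simple hp); rewrite -?es' -?et'.
by apply: s's; rewrite es' fe.
Qed.

(* The shorter of the two sides of an empty pocket turns away from the pocket. *)
Lemma pocket_end : ~ (exists w, pocket w) -> s'.2 = false \/ t'.2 = true.
Proof.
have [c1 c2 c3 c4] := ctx.
move=> /forallNP np.
have [le1|lt1] := leP (rx s') (rx t').
  left; apply/negP => s2.
  case es' : s' => [f b]; rewrite es' /= in s2; rewrite s2 in es'.
  (* The partner of [s'] arrives at the common bend between [t'] and [s'], so by [trap2] its foot
     would lie in the pocket. *)
  pose a := (f, false).
  have ra : rx a = rx s' by rewrite es'.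
  have las : le a s' by rewrite es'; apply: hp_up hp _.
  have nas : a <> s' by rewrite es'.
  have nat : a <> t' by move=> et; apply: (same_ends es').
  have nst : s'.1 <> t'.1.
    case et' : t' => [g c]; rewrite es' /= => fg; case: c et' => et'.
      by apply: s't'; rewrite es' et' fg.
    by apply: nat; rewrite et' -fg.
  have za := rx_gt a.
  have lta : le t' a.
    apply: (below_at total (x := rx s')); rewrite /dom ?zt; try lra.
    by have := lt's'_lt les (lexx _) le1 nst; rewrite /rx es' /= (hp_b hp).
  have nae : a.1 <> e by move=> /= fe; apply: s's; rewrite es' fe.
  have zae : bx e < px (z a) by apply: trap2 => //; lra.
  by apply: (np (z a)); apply: in_pocket => //; rewrite le_min; lra.
right; apply: contrapT => /negP t2.
case et' : t' => [f b]; rewrite et' /= in t2; rewrite (negbTE t2) in et'.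
pose a := (f, true).
have ra : rx a = rx t' by rewrite et'.
have lta : le t' a by rewrite et'; apply: hp_up hp _.
have nat : a <> t' by rewrite et'.
have nas : a <> s' by move=> es; apply: (same_ends (esym es)).
have nst : s'.1 <> t'.1.
  case es' : s' => [g c]; rewrite et' /= => fg; case: c es' => es'.
    by apply: nas; rewrite es' fg.
  by apply: s't'; rewrite es' et' fg.
have za := rx_gt a.
have las : le a s'.
  apply: (below_at total (x := rx t')); rewrite /dom ?zs; try lra.
  by have := lt's'_lt (ltW ltt) (ltW lt1) (lexx _) nst; rewrite /rx et' /= (hp_b hp).
have nae : a.1 <> e by move=> /= fe; move: ltt; rewrite et' /rx /= fe ltxx.
have zae : bx e < px (z a) by apply: trap2 => //; lra.
by apply: (np (z a)); apply: in_pocket => //; rewrite le_min; lra.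
Qed.

End Pocket.

(* A hairpin outside [G1] and [G2] is charged to the deficit in [G_card].  For the
   others, the pocket to the right of the bend either shows a vertex directly below
   the next half above, or is closed by a hairpin outside [G1] or [G2]. *)
Lemma hairpins_card : (#|E| <= 5 * #|V|)%N.
Proof.
pose K0 := [set e | `[<exists2 s', consecutive (e, true) s' &
                         exists w, first_above s' w>]].
pose K1 := [set e | `[<exists2 f, consecutive (e, true) (f, false) & f \notin G2>]].
pose K2 := [set e | `[<exists2 f, consecutive (f, true) (e, false) & f \notin G1>]].
have c0 : (#|K0| <= #|V|)%N.
  rewrite -cardsT; apply: (@leq_card_witness _ _ _ _ (fun e w =>
    exists2 s', consecutive (e, true) s' & first_above s' w)).
    by move=> e; rewrite inE => /asboolP [s' cs [w fw]]; exists w => //; exists s'.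
  move=> e f w [s cs [s1 s2 s3]] [t ct [t1 t2 t3]].
  have est : s = t by case: (total s t) => [/t3->|/s3->].
  by rewrite -est in ct; case: (consec_inj total cs ct).
have c1 : (#|K1| <= #|~: G2|)%N.
  apply: (@leq_card_witness _ _ _ _ (fun e f => consecutive (e, true) (f, false))).
    by move=> e; rewrite inE => /asboolP [f cf nf]; exists f; rewrite ?in_setC.
  by move=> e f g ce cf; case: (consec_inj total ce cf).
have c2 : (#|K2| <= #|~: G1|)%N.
  apply: (@leq_card_witness _ _ _ _ (fun e f => consecutive (f, true) (e, false))).
    by move=> e; rewrite inE => /asboolP [f cf nf]; exists f; rewrite ?in_setC.
  by move=> e f g ce cf; case: (consec_fun total ce cf).
have cov : [set: E] \subset ~: G1 :|: ~: G2 :|: (K0 :|: (K1 :|: K2)).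
  apply/fintype.subsetP => e _; rewrite !in_setU !in_setC.
  case: (boolP (e \in G1)) => //=; rewrite inE => /asboolP [s' ns les].
  case: (boolP (e \in G2)) => //=; rewrite inE => /asboolP [t' nt ltt].
  have [ex|nex] := pselect (exists w, pocket e s' t' w).
    apply/orP; left; rewrite inE; apply/asboolP; exists s'; first by case: ns.
    by apply: pocket_visible ex.
  apply/orP; right; case: (pocket_end ns nt les ltt nex) => h; apply/orP.
    left; rewrite inE; apply/asboolP; move: h ns les; case: s' {nex} => f b /= -> ns les.
    exists f; first by case: ns.
    rewrite inE; apply/asboolP => -[s1 [cs1 _]]; have [cs _] := ns.
    by rewrite (consec_inj total cs1 cs) => lt; move: les; rewrite leNgt lt.
  right; rewrite inE; apply/asboolP; move: h nt ltt; case: t' {nex} => f b /= -> nt ltt.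
  exists f; first by case: nt.
  rewrite inE; apply/asboolP => -[s1 [cs1 _]]; have [cs _] := nt.
  by rewrite (consec_fun total cs1 cs) => lt; move: ltt; rewrite ltNge lt.
(* [K0] contributes [#|V|]. Each complement of [G1] and [G2] is used twice, once directly and once
   through [K1] or [K2], and [G_card] bounds this by [4 * #|V|]. *)
have := subset_leq_card cov; rewrite cardsT.
have := (leq_card_setU (~: G1 :|: ~: G2) (K0 :|: (K1 :|: K2))).1.
have := (leq_card_setU (~: G1) (~: G2)).1; have := (leq_card_setU K0 (K1 :|: K2)).1.
have := (leq_card_setU K1 K2).1; have := cardsC G1; have := cardsC G2; have := G_card.
move: c0 c1 c2.
move: #|K0| #|K1| #|K2| #|~: G1| #|~: G2| #|G1| #|G2| #|E| #|V| #|K1 :|: K2|.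
move: #|~: G1 :|: ~: G2| #|K0 :|: (K1 :|: K2)|.
move: #|~: G1 :|: ~: G2 :|: (K0 :|: (K1 :|: K2))|.
clear; lia.
Qed.

End Hairpins.

(** * Drawings with at most one bend per edge *)

Definition bent (R : realType) (p y m1 m2 x : R) :=
  y + (if x <= p then m1 else m2) * (x - p).

(** A form without case distinction, from which continuity can be read off. *)
Lemma bent_abs (R : realType) (p y m1 m2 x : R) :
  bent p y m1 m2 x = y + ((m1 + m2) / 2 * (x - p) + (m2 - m1) / 2 * `|x - p|).
Proof.
rewrite /bent; case: (leP x p) => h.
  by rewrite ler0_norm ?subr_le0 //; field.
by rewrite gtr0_norm ?subr_gt0 //; field.
Qed.

Lemma bent_continuous (R : realType) (p y m1 m2 : R) : continuous (bent p y m1 m2).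
Proof.
have -> : bent p y m1 m2 = fun x =>
    y + ((m1 + m2) / 2 * (x - p) + (m2 - m1) / 2 * `|x - p|).
  by apply: funext => x; exact: bent_abs.
move=> x; apply: cvgD; first exact: cvg_cst.
have cB : continuous (fun x : R => x - p).
  by move=> z; apply: cvgB; [exact: cvg_id|exact: cvg_cst].
by apply: cvgD; apply: cvgM; [exact: cvg_cst|exact: cB|exact: cvg_cst|exact: (cvg_norm (cB x))].
Qed.

Lemma continuous_meet (R : realType) (f g : R -> R) x1 x2 :
  continuous f -> continuous g -> f x1 < g x1 -> g x2 < f x2 ->
  exists x, [/\ Num.min x1 x2 < x, x < Num.max x1 x2 & f x = g x].
Proof.
move=> cf cg.
wlog: f g x1 x2 cf cg / x1 <= x2.
  move=> H lt1 lt2; case/orP: (le_total x1 x2) => le; first exact: H.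
  have [x [h1 h2 h3]] := H g f x2 x1 cg cf le lt2 lt1.
  by exists x; rewrite minC maxC.
move=> le lt1 lt2.
have ch : continuous (f \- g) by move=> x; apply: cvgB; [exact: cf|exact: cg].
have [|c] := @IVT R (f \- g) x1 x2 0 le (continuous_subspaceT ch).
  by rewrite ge_min le_max /= subr_le0 (ltW lt1) !subr_ge0 (ltW lt2) orbT.
rewrite in_itv /= => /andP [c1 c2] /eqP; rewrite subr_eq0 => /eqP fg.
exists c; rewrite (min_idPl le) (max_idPr le); split=> //.
  by rewrite lt_neqAle c1 andbT; apply: contraTneq lt1 => ->; rewrite fg ltxx.
by rewrite lt_neqAle c2 andbT; apply: contraTneq lt2 => <-; rewrite fg ltxx.
Qed.

(** The source of the totality of [below]: by the intermediate value theorem, a change of sides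
    forces a common point strictly inside both intervals. *)
Lemma continuous_total (R : realType) (f g : R -> R) (a b c d : R) :
  continuous f -> continuous g ->
  (forall x, a < x < b -> c < x < d -> f x <> g x) ->
  (forall x, a <= x <= b -> c <= x <= d -> f x <= g x) \/
  (forall x, a <= x <= b -> c <= x <= d -> g x <= f x).
Proof.
move=> cf cg ne; case: (pselect (forall x, a <= x <= b -> c <= x <= d -> f x <= g x)).
  by left.
move=> /existsNP [x1 /not_implyP [ab1 /not_implyP [cd1 /negP]]].
rewrite -ltNge => lt1; right=> x2 ab2 cd2; rewrite leNgt; apply/negP => lt2.
have [x [h1 h2 eqx]] := continuous_meet cf cg lt2 lt1.
have [l1 l2] : a < x /\ c < x.
  by split; apply: le_lt_trans h1; rewrite le_min; lra.
have [l3 l4] : x < b /\ x < d.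
  by split; apply: (lt_le_trans h2); rewrite ge_max; lra.
by apply: ne eqx; apply/andP.
Qed.

(* The half-edge [(e, b)] is the segment from its vertex [foot (e, b)] to the bend of
   [e], given in generic coordinates. *)
Record layout (R : realType) (V E : finType) := Layout {
  foot : E * bool -> V;
  vx : V -> R; vy : V -> R;
  bx : E -> R; by_ : E -> R }.

Section Layout.
Variables (R : realType) (V E : finType).
Implicit Types (L : layout R V E) (h k : E * bool).

Definition slope L h := (by_ L h.1 - vy L (foot L h)) / (bx L h.1 - vx L (foot L h)).
Definition line L h (x : R) : R := by_ L h.1 + slope L h * (x - bx L h.1).
Definition span L h x :=
  (vx L (foot L h) <= x <= bx L h.1) || (bx L h.1 <= x <= vx L (foot L h)).
Definition other h : E * bool := (h.1, ~~ h.2).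

(* The bend of an edge drawn without bends is an artificial point of a straight
   segment, so that a crossing may occur there. *)
Definition crossing L h k x :=
  [/\ slope L h * slope L k = -1, x <> vx L (foot L h), x <> vx L (foot L k),
      x = bx L h.1 -> slope L (other h) = slope L h &
      x = bx L k.1 -> slope L (other k) = slope L k].

Definition share_foot L h k x := foot L h = foot L k /\ x = vx L (foot L h).

(** The coordinates are generic: by [dr_vert] and [dr_hor] each half is the graph of an affine
    function whose slope has a sign. *)
Record drawing L : Prop := Drawing {
  dr_inj : forall v w, vx L v = vx L w -> vy L v = vy L w -> v = w;
  dr_loopless : forall e, foot L (e, true) <> foot L (e, false);
  dr_simple : forall h k, foot L h = foot L k -> foot L (other h) = foot L (other k) ->
    h.1 = k.1;
  dr_vert : forall h, vx L (foot L h) <> bx L h.1;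
  dr_hor : forall h, slope L h <> 0;
  dr_bend : forall e x, span L (e, true) x -> span L (e, false) x ->
    line L (e, true) x = line L (e, false) x -> x = bx L e;
  dr_cross : forall h k x, h.1 <> k.1 -> span L h x -> span L k x ->
    line L h x = line L k x -> share_foot L h k x \/ crossing L h k x }.

Definition plane L (A : {set E}) := forall h k x, h.1 \in A -> k.1 \in A ->
  h.1 <> k.1 -> span L h x -> span L k x -> line L h x = line L k x ->
  share_foot L h k x.

(** Meant for signs [sx], [sy]: all slopes are multiplied by the same sign [sy * sx], so the
    products of slopes that express right angles are kept. *)
Definition flip (sx sy : R) L : layout R V E :=
  Layout (foot L) (fun v => sx * vx L v) (fun v => sy * vy L v)
    (fun e => sx * bx L e) (fun e => sy * by_ L e).

Lemma line_foot L h : drawing L -> line L h (vx L (foot L h)) = vy L (foot L h).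
Proof.
move=> D; rewrite /line /slope -[vx L _ - _]opprB mulrN divfK ?subKr //.
by rewrite subr_eq0; apply/eqP/nesym/(dr_vert D).
Qed.

Lemma line_bend L h : line L h (bx L h.1) = by_ L h.1.
Proof. by rewrite /line subrr mulr0 addr0. Qed.

Lemma otherK h : other (other h) = h.
Proof. by case: h => e b; rewrite /other /= negbK. Qed.

Lemma dr_bend_other L h x : drawing L -> span L h x -> span L (other h) x ->
  line L h x = line L (other h) x -> x = bx L h.1.
Proof.
move=> D; case: h => e [] /= s1 s2 l12; first exact: (dr_bend D) l12.
by apply: (dr_bend D) => //; rewrite -l12.
Qed.

Lemma foot_other L h : drawing L -> foot L h <> foot L (other h).
Proof.
by move=> D; case: h => e [] //=; [|apply/nesym]; apply: (dr_loopless D).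
Qed.

Lemma same_edge h k : h.1 = k.1 -> k = h \/ k = other h.
Proof. by case: h k => [e [] ] [f []] /= <-; [left|right|right|left]. Qed.


Section Flip.
Variables (sx sy : R) (L : layout R V E).
Hypotheses (sx1 : sx ^+ 2 = 1) (sy1 : sy ^+ 2 = 1).

Let L' := flip sx sy L.

Let sx0 : sx != 0. Proof. by rewrite -sqrf_eq0 sx1 oner_eq0. Qed.
Let sy0 : sy != 0. Proof. by rewrite -sqrf_eq0 sy1 oner_eq0. Qed.
Let sxK : sx * sx = 1. Proof. by rewrite -expr2. Qed.
Let syK : sy * sy = 1. Proof. by rewrite -expr2. Qed.

Lemma slope_flip h : slope L' h = sy * sx * slope L h.
Proof.
have sxV : sx^-1 = sx by apply: (mulfI sx0); rewrite sxK mulfV.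
by rewrite /slope /= -!mulrBr invfM sxV; ring.
Qed.

Lemma line_flip h x : line L' h x = sy * line L h (sx * x).
Proof.
rewrite /line slope_flip /=.
have -> : sx * x - bx L h.1 = sx * (x - sx * bx L h.1) by rewrite mulrBr mulrA sxK mul1r.
by ring.
Qed.

Lemma span_flip h x : span L' h x = span L h (sx * x).
Proof.
rewrite /span /=.
have /orP [/eqP e|/eqP e] : (sx == 1) || (sx == -1) by rewrite -eqf_sqr sx1 expr1n.
  by rewrite e !mul1r.
rewrite e !mulN1r; set a := vx L _; set b := bx L _.
by rewrite (lerNl a) (lerNl b) (lerNr x a) (lerNr x b) orbC andbC [X in _ || X]andbC.
Qed.

Let sxE x y : x = sx * y -> sx * x = y.
Proof. by move=> ->; rewrite mulrA sxK mul1r. Qed.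

Let sxI x y : sx * x = y -> x = sx * y.
Proof. by move=> <-; rewrite mulrA sxK mul1r. Qed.

Let slopes h k : slope L' h = slope L' k <-> slope L h = slope L k.
Proof.
rewrite !slope_flip; split=> [|->] //; apply: mulfI.
by rewrite mulf_neq0.
Qed.

Lemma drawing_flip : drawing L -> drawing L'.
Proof.
case=> inj ll si ve ho be cr; split=> //=.
- by move=> v w /(mulfI sx0) e1 /(mulfI sy0); apply: inj.
- by move=> h /(mulfI sx0); apply: ve.
- by move=> h; rewrite slope_flip; apply/eqP/mulf_neq0; [exact: mulf_neq0|apply/eqP; exact: ho].
- move=> e x; rewrite !span_flip !line_flip => s1 s2 /(mulfI sy0) ll12.
  by apply: sxI; apply: be.
- move=> h k x nhk; rewrite !span_flip !line_flip => s1 s2 /(mulfI sy0) ll12.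
  case: (cr _ _ _ nhk s1 s2 ll12) => [[f1 f2]|[c1 c2 c3 c4 c5]]; [left|right].
    by split=> //=; apply: sxI.
  split=> /=.
  + rewrite !slope_flip -[RHS]c1 mulrACA [sy * sx * _]mulrACA sxK syK.
    by rewrite mulr1 mul1r.
  + by move=> /sxE.
  + by move=> /sxE.
  + by move=> /sxE /c4 /slopes.
  + by move=> /sxE /c5 /slopes.
Qed.

Lemma plane_flip A : plane L A -> plane L' A.
Proof.
move=> pl h k x hA kA nhk; rewrite !span_flip !line_flip => s1 s2 /(mulfI sy0) ll12.
have [f1 f2] := pl _ _ _ hA kA nhk s1 s2 ll12.
by split=> //=; apply: sxI.
Qed.

End Flip.

Lemma line_bent L h x : line L h x = bent (bx L h.1) (by_ L h.1) (slope L h) (slope L h) x.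
Proof. by rewrite /bent if_same. Qed.

Lemma line_continuous L h : continuous (line L h : R -> R).
Proof.
have -> : line L h = bent (bx L h.1) (by_ L h.1) (slope L h) (slope L h).
  by apply: funext => x; exact: line_bent.
exact: bent_continuous.
Qed.

End Layout.
Arguments other {E}.

(** * Non-crossing hairpins of a drawing *)

Section Hairpin.
Variables (R : realType) (V E : finType) (L : layout R V E) (A : {set E}).
Hypotheses (D : drawing L) (P : plane L A).
Hypothesis toright : forall e b, e \in A -> vx L (foot L (e, b)) < bx L e.

Let E' : finType := {e : E | e \in A}.

(** To the left of the bend the half of smaller slope is the upper one. [half] renames the halves so
    that [true] stands for the upper one, as [hairpins] requires. *)
Let upper (e : E) := slope L (e, true) < slope L (e, false).
Let half (s : E' * bool) : E * bool := (val s.1, s.2 == upper (val s.1)).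

Let half_other (s : E' * bool) : half (other s) = other (half s).
Proof. by rewrite /half /other /=; case: s => e [] /=; case: (upper _). Qed.

Let halfA s : (half s).1 \in A. Proof. exact: valP s.1. Qed.

Let half_right s : vx L (foot L (half s)) < bx L (val s.1).
Proof. exact: toright (halfA s). Qed.

Let spanE s x : dom (vx L) (foot L \o half) ((bx L \o val) \o fst) s x -> span L (half s) x.
Proof. by rewrite /dom /span /= => ->. Qed.

Let disj s t x : s <> t -> dom (vx L) (foot L \o half) ((bx L \o val) \o fst) s x ->
    dom (vx L) (foot L \o half) ((bx L \o val) \o fst) t x ->
    line L (half s) x = line L (half t) x ->
  (foot L (half s) = foot L (half t) /\ x = vx L (foot L (half s))) \/
  (s.1 = t.1 /\ x = bx L (val s.1)).
Proof.
move=> nst ds dt eql; have ss := spanE ds; have st := spanE dt.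
case: (pselect (s.1 = t.1)) => [est|nest]; [right|left].
  split=> //; case: (same_edge est) => [ets|ets]; first by rewrite ets in nst.
  rewrite {}ets half_other in eql st.
  exact: (dr_bend_other D (h := half s)) eql.
apply: P => //; rewrite ?halfA //.
by move=> /val_inj.
Qed.

Lemma hairpin_card : (#|A| <= 5 * #|V|)%N.
Proof.
have -> : #|A| = #|E'| by rewrite card_sig; apply: eq_card => e; rewrite inE.
apply: (@hairpins_card R V E' (vx L) (vy L) (foot L \o half) (bx L \o val)
   (fun s => line L (half s))).
split=> /=.
- by move=> s; apply: half_right.
- by move=> s; apply: line_foot.
- by move=> e; rewrite !line_bend.
- move=> e x; rewrite /dom /= => /andP [_ h1] _.
  rewrite /line /= lerD2l; apply: ler_wnM2r; first by rewrite subr_le0.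
  by rewrite /half /=; rewrite /upper; case: ltP => // /ltW.
- exact: dr_inj D.
- move=> s t; case: (pselect (s = t)) => [->|nst]; first by left.
  have [||||] := @continuous_total R (line L (half s)) (line L (half t))
    (vx L (foot L (half s))) (bx L (val s.1)) (vx L (foot L (half t))) (bx L (val t.1)).
  + exact: line_continuous.
  + exact: line_continuous.
  + move=> x ls lt eql.
    have ds : dom (vx L) (foot L \o half) ((bx L \o val) \o fst) s x by rewrite /dom /=; lra.
    have dt : dom (vx L) (foot L \o half) ((bx L \o val) \o fst) t x by rewrite /dom /=; lra.
    by case: (disj nst ds dt eql) => -[_ ex]; move: ls; rewrite ex ltxx ?andbF.
  + by left.
  + by move=> H; right=> x dt ds; apply: H.
- exact: disj.
- by move=> e; rewrite -[foot L (half (e, false))]/(foot L (half (other (e, true)))) half_other;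
    apply: foot_other.
- move=> e f h1 h2; apply: val_inj.
  apply: (@dr_simple _ _ _ _ D (half (e, true)) (half (f, true))) => //.
Qed.

End Hairpin.

(** * Non-crossing x-monotone edges of a drawing *)

Section Monotone.
Variables (R : realType) (V E : finType) (L : layout R V E) (A : {set E}).
Hypotheses (D : drawing L) (P : plane L A).
Hypothesis mono : forall e, e \in A ->
  (vx L (foot L (e, true)) < bx L e) != (vx L (foot L (e, false)) < bx L e).

Let E' : finType := {e : E | e \in A}.
(** The half to the left of the bend: by [mono], if it is not the half [true], it is the half
    [false]. *)
Let lh (e : E') : E * bool := (val e, vx L (foot L (val e, true)) < bx L (val e)).
Let rh (e : E') := other (lh e).
Let l (e : E') := foot L (lh e).
Let r (e : E') := foot L (rh e).
Let F (e : E') := bent (bx L (val e)) (by_ L (val e)) (slope L (lh e)) (slope L (rh e)).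

Let lhx e : vx L (l e) < bx L (val e).
Proof.
have := mono (valP e); rewrite /l /lh.
by case lt: (_ < _) => //=; case lt': (_ < _).
Qed.

Let rhx e : bx L (val e) < vx L (r e).
Proof.
rewrite lt_neqAle; apply/andP; split.
  by rewrite eq_sym; apply/eqP; apply: (dr_vert D (h := rh e)).
have := mono (valP e); rewrite /r /rh /other /lh /=.
case: (vx L (foot L (val e, true)) < _) / ltP => //= h.
by case: ltP.
Qed.

Let Fl e x : x <= bx L (val e) -> F e x = line L (lh e) x.
Proof. by move=> h; rewrite /F /bent h. Qed.

Let Fr e x : bx L (val e) <= x -> F e x = line L (rh e) x.
Proof.
move=> h; rewrite /F /bent; case: ifP => // h'.
have -> : x = bx L (val e) by apply/le_anti; rewrite h h'.
by rewrite /line /= subrr !mulr0.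
Qed.

Let piece e x : vx L (l e) <= x <= vx L (r e) ->
  exists h, [/\ h.1 = val e, span L h x & F e x = line L h x].
Proof.
move=> dx; case: (lerP x (bx L (val e))) => h.
  by exists (lh e); split=> //; [apply/orP; left; rewrite -/(l e) /=; lra|exact: Fl].
exists (rh e); split=> //; [apply/orP; right; rewrite -/(r e) /=; lra|].
by apply: Fr; exact: ltW.
Qed.

Let foot_end (h : E * bool) (e : E') : h.1 = val e -> foot L h = l e \/ foot L h = r e.
Proof.
move=> he; have [->|->] := @same_edge E (lh e) h (esym he); [by left|by right].
Qed.

Let end_foot (e : E') w : w = l e \/ w = r e -> exists2 h, h.1 = val e & w = foot L h.
Proof. by case=> ->; [exists (lh e)|exists (rh e)]. Qed.

Lemma monotone_card : (#|A| <= 3 * #|V|)%N.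
Proof.
have -> : #|A| = #|E'| by rewrite card_sig; apply: eq_card => e; rewrite inE.
apply: (@plane_arcs_card R V E' (vx L) (vy L) l r F).
split.
- by move=> e; apply: lt_trans (lhx e) (rhx e).
- by move=> e; rewrite Fl ?(ltW (lhx e)) // line_foot.
- by move=> e; rewrite Fr ?(ltW (rhx e)) // line_foot.
- by move=> e f v w _ _; apply: dr_inj D _ _.
- move=> e f; case: (pselect (e = f)) => [->|nef]; first by left.
  have [||||] := @continuous_total R (F e) (F f) (vx L (l e)) (vx L (r e))
     (vx L (l f)) (vx L (r f)).
  + exact: bent_continuous.
  + exact: bent_continuous.
  + move=> x le lf eqF.
    have [|h [he sh Fh]] := @piece e x; first by lra.
    have [|k [kf sk Fk]] := @piece f x; first by lra.
    have hk : h.1 <> k.1 by rewrite he kf => /val_inj.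
    have hA : h.1 \in A by rewrite he; exact: valP.
    have kA : k.1 \in A by rewrite kf; exact: valP.
    have [|_ xh] := P hA kA hk sh sk; first by rewrite -Fh -Fk.
    by case: (foot_end he) => eh; rewrite xh eh ltxx ?andbF in le.
  + by left.
  + by move=> H; right=> x dt ds; apply: H.
- move=> e f w /end_foot [k kf ->] lw Fw.
  have [|h [he sh Fh]] := @piece e (vx L (foot L k)); first by lra.
  have [ef|nef] := pselect (e = f).
    rewrite -ef in kf; move: lw; case: (foot_end kf) => ->; rewrite ltxx ?andbF //.
  have sk : span L k (vx L (foot L k)).
    by rewrite /span lexx /= andbT le_total.
  have hk : h.1 <> k.1 by rewrite he kf => /val_inj.
  have hA : h.1 \in A by rewrite he; exact: valP.
  have kA : k.1 \in A by rewrite kf; exact: valP.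
  have [|_ xh] := P hA kA hk sh sk; first by rewrite -Fh Fw line_foot.
  by move: lw; rewrite xh; case: (foot_end he) => ->; rewrite ltxx ?andbF.
- move=> e f le lf; apply: val_inj.
  by apply: (dr_simple D (h := lh e) (k := lh f)).
Qed.

End Monotone.

(** 13 = 5 + 5 + 3: hairpins with the bend to the right of both feet, hairpins with the bend to the
    left (reflected), and x-monotone edges. *)
Lemma plane_card (R : realType) (V E : finType) (L : layout R V E) (A : {set E}) :
  drawing L -> plane L A -> (#|A| <= 13 * #|V|)%N.
Proof.
move=> D P.
pose s (b : bool) e := vx L (foot L (e, b)) < bx L e.
pose A1 := [set e in A | s true e && s false e].
pose A2 := [set e in A | ~~ s true e && ~~ s false e].
pose A3 := [set e in A | s true e != s false e].
have sub (B : {set E}) : B \subset A -> plane L B.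
  by move=> /fintype.subsetP BA h k x /BA hA /BA kA; apply: P.
have c1 : (#|A1| <= 5 * #|V|)%N.
  apply: (hairpin_card D).
    by apply: sub; apply/fintype.subsetP => e; rewrite inE => /andP [].
  by move=> e b; rewrite inE => /and3P [_ h1 h2]; case: b.
have c2 : (#|A2| <= 5 * #|V|)%N.
  have sx1 : (-1 : R) ^+ 2 = 1 by rewrite sqrrN expr1n.
  have sy1 : (1 : R) ^+ 2 = 1 by rewrite expr1n.
  apply: (hairpin_card (drawing_flip sx1 sy1 D)).
    apply: plane_flip => //.
    by apply: sub; apply/fintype.subsetP => e; rewrite inE => /andP [].
  move=> e b; rewrite inE => /and3P [_ h1 h2] /=; rewrite !mulN1r ltrN2.
  have h : ~~ s b e by case: b.
  rewrite lt_neqAle leNgt h andbT eq_sym; apply/eqP.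
  exact: (dr_vert D (h := (e, b))).
have c3 : (#|A3| <= 3 * #|V|)%N.
  apply: (monotone_card D).
    by apply: sub; apply/fintype.subsetP => e; rewrite inE => /andP [].
  by move=> e; rewrite inE => /andP [].
have cov : A \subset A1 :|: A2 :|: A3.
  apply/fintype.subsetP => e eA; rewrite !inE eA /=.
  by case: (s true e); case: (s false e).
have := subset_leq_card cov.
have := (leq_card_setU (A1 :|: A2) A3).1; have := (leq_card_setU A1 A2).1.
move: c1 c2 c3; move: #|A1| #|A2| #|A3| #|V| #|A| #|A1 :|: A2| #|A1 :|: A2 :|: A3|.
clear; lia.
Qed.

(** * Edges with one falling and one rising half *)

(** Out-degrees are at most [d], so by double counting some in-degree is at most [d] as well.
    Putting such an element into [I] discards at most [2d + 1] elements, itself included; then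
    induct. *)
Lemma independent_set (T : finType) (r : rel T) (d : nat) (U : {set T}) :
  (forall x, x \in U -> #|[set y in U | r x y]| <= d)%N ->
  exists I : {set T}, [/\ I \subset U,
    forall x y, x \in I -> y \in I -> x <> y -> ~~ r x y &
    (#|U| <= d.*2.+1 * #|I|)%N].
Proof.
move: {2}#|U| (leqnn #|U|) => n; elim: n U => [|n IH] U sU out.
  exists set0; split; rewrite ?sub0set //; first by move=> x y; rewrite inE.
  by rewrite cards0 muln0.
have [->|[x0 x0U]] := set_0Vmem U.
  exists set0; split; rewrite ?sub0set //; first by move=> x y; rewrite inE.
  by rewrite !cards0 muln0.
have [x xU inx] : exists2 x, x \in U & (#|[set y in U | r y x]| <= d)%N.
  apply: contrapT => nex.
  have lt x : x \in U -> (d.+1 <= #|[set y in U | r y x]|)%N.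
    by move=> xU; rewrite ltnNge; apply/negP => le; apply: nex; exists x.
  have : (\sum_(x in U) d.+1 <= \sum_(x in U) d)%N.
    apply: (@leq_trans (\sum_(x in U) #|[set y in U | r y x]|)%N).
      exact: leq_sum.
    suff -> : (\sum_(x in U) #|[set y in U | r y x]| =
               \sum_(y in U) #|[set x in U | r y x]|)%N by apply: leq_sum.
    transitivity (\sum_(x in U) \sum_(y in U) (r y x : nat))%N.
      apply: eq_bigr => x _; rewrite -sum1_card big_mkcond /= [RHS]big_mkcond /=.
      by apply: eq_bigr => y _; rewrite inE; case: (y \in U); case: (r y x).
    rewrite exchange_big; apply: eq_bigr => y _ /=.
    rewrite -sum1_card big_mkcond /= [RHS]big_mkcond /=.
    by apply: eq_bigr => x _; rewrite inE; case: (x \in U); case: (r y x).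
  rewrite !sum_nat_const leq_pmul2l ?ltnn //.
  by apply/card_gt0P; exists x0.
pose N := x |: ([set y in U | r x y] :|: [set y in U | r y x]).
have cN : (#|N| <= d.*2.+1)%N.
  rewrite cardsU1 -add1n -addnn; apply: leq_add; first by case: (_ \notin _).
  exact: leq_trans (leq_card_setU _ _).1 (leq_add (out _ xU) inx).
have cUN : (#|U :\: N| < #|U|)%N.
  apply: proper_card; apply/properP; split; first exact: subsetDl.
  by exists x => //; rewrite in_setD in_setU1 eqxx.
have [||I [IU ind cI]] := IH (U :\: N).
- by rewrite -ltnS; apply: leq_trans cUN _.
- move=> y; rewrite inE => /andP [_ yU]; apply: leq_trans (out _ yU).
  by apply/subset_leq_card/fintype.subsetP => z; rewrite !inE => /andP [/andP [_ ->]].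
have far y : y \in I -> [/\ y \in U, y <> x, ~~ r x y & ~~ r y x].
  move=> /(fintype.subsetP IU); rewrite !inE !negb_or !negb_and.
  by case/andP => /and3P [/eqP nyx h1 h2] yU; move: h1 h2; rewrite yU.
exists (x |: I); split.
- apply/fintype.subsetP => y; rewrite in_setU1 => /orP [/eqP->|/far []] //.
- move=> y z; rewrite !in_setU1 => /orP [/eqP->|yI] /orP [/eqP->|zI] // nyz.
  + by have [] := far _ zI.
  + by have [] := far _ yI.
  + exact: ind.
have xI : x \notin I by apply/negP => /far [].
rewrite cardsU1 xI mulnDr muln1.
have := cardsID N U; rewrite [in X in (X -> _)]addnC => <-.
rewrite addnC leq_add //.
by apply: leq_trans cN; apply/subset_leq_card/subsetIr.
Qed.

Section Mixed.
Variables (R : realType) (V E : finType) (L : layout R V E) (A : {set E}).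
Hypothesis D : drawing L.

(* On [A], [nh e] is the half of negative slope and [ph e] that of positive slope. *)
Definition nh (e : E) : E * bool := (e, slope L (e, true) < 0).
Definition ph (e : E) : E * bool := other (nh e).

Hypothesis mixed : forall e, e \in A ->
  [/\ slope L (nh e) < 0, 0 < slope L (ph e) & vx L (foot L (nh e)) < bx L e].

Let nfree e f x : e \in A -> f \in A -> e <> f -> span L (nh e) x -> span L (nh f) x ->
  line L (nh e) x = line L (nh f) x -> share_foot L (nh e) (nh f) x.
Proof.
move=> /mixed [ne _ _] /mixed [nf _ _] nef se sf ll.
case: (dr_cross D (h := nh e) (k := nh f) nef se sf ll) => // -[c _ _ _ _].
have : 0 < slope L (nh e) * slope L (nh f) by rewrite nmulr_rgt0.
by rewrite c ltr0N1.
Qed.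

Let pfree e f x : e \in A -> f \in A -> e <> f -> span L (ph e) x -> span L (ph f) x ->
  line L (ph e) x = line L (ph f) x -> share_foot L (ph e) (ph f) x.
Proof.
move=> /mixed [_ pe _] /mixed [_ pf _] nef se sf ll.
case: (dr_cross D (h := ph e) (k := ph f) nef se sf ll) => // -[c _ _ _ _].
by have := mulr_gt0 pe pf; rewrite c ltr0N1.
Qed.

(** The positive half may leave its foot in either direction, hence the minimum and the maximum. *)
Definition inside (f : E) x :=
  Num.min (vx L (foot L (ph f))) (bx L f) < x < Num.max (vx L (foot L (ph f))) (bx L f).

Let inside_span f x : inside f x -> span L (ph f) x.
Proof.
rewrite /inside /span; set a := vx L _; set b := bx L _.
by case: (ltP a b) => h /andP [/ltW -> /ltW ->]; rewrite ?orbT.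
Qed.

Let inside_foot f x : inside f x -> x <> vx L (foot L (ph f)).
Proof.
rewrite /inside; set a := vx L _; set b := bx L _.
by case: (ltP a b) => h /andP [h1 h2] e; move: h1 h2; rewrite e ltxx.
Qed.

Let inside_bend f x : inside f x -> x <> bx L f.
Proof.
rewrite /inside; set a := vx L _; set b := bx L _.
by case: (ltP a b) => h /andP [h1 h2] e; move: h1 h2; rewrite e ltxx.
Qed.

Let span_inside f x : span L (ph f) x -> x <> vx L (foot L (ph f)) -> x <> bx L f ->
  inside f x.
Proof.
rewrite /inside /span /=; set a := vx L _; set b := bx L _ => s /eqP h1 /eqP h2.
case/orP: s => /andP [l1 l2].
  rewrite (min_idPl (le_trans l1 l2)) (max_idPr (le_trans l1 l2)).
  by rewrite !lt_neqAle l1 l2 eq_sym h1 h2.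
rewrite (min_idPr (le_trans l1 l2)) (max_idPl (le_trans l1 l2)).
by rewrite !lt_neqAle l1 l2 eq_sym h1 h2.
Qed.

Definition crossed_at f e x := [/\ f <> e, vx L (foot L (nh e)) < x < bx L e,
  inside f x, line L (nh e) x = line L (ph f) x &
  slope L (nh e) * slope L (ph f) = -1].
Definition crosses f e := `[<exists x, crossed_at f e x>].
(** The abscissa of the crossing, with the dummy value 0 if there is none. *)
Definition ix f e : R :=
  if pselect (exists x, crossed_at f e x) is left ex then projT1 (cid ex) else 0.

Let ixP f e : crosses f e -> crossed_at f e (ix f e).
Proof.
by rewrite /ix => /asboolP ex; case: pselect => // ex'; exact: projT2 (cid ex').
Qed.

(** Lines with slopes of opposite signs have only one common point. *)
Let ixE f e x : e \in A -> f \in A -> crossed_at f e x -> crosses f e /\ ix f e = x.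
Proof.
move=> /mixed [ne _ _] /mixed [_ pf _] c.
have cr : crosses f e by apply/asboolP; exists x.
split=> //; have [_ _ _ l1 _] := ixP cr; have [_ _ _ l2 _] := c.
move: l1 l2; rewrite /line; move: ne pf.
set a := slope L _; set b := slope L _; set y := ix f e => an bp l1 l2.
have : (a - b) * (y - x) = 0 by move: l1 l2; set u := bx L _; set v := bx L _ => l1 l2; lra.
by move/eqP; rewrite mulf_eq0 !subr_eq0 => /orP [/eqP|/eqP] //; lra.
Qed.

(** The bends of mixed edges are real, since the slopes of their halves have opposite signs. So a
    crossing never lies at a bend and is strictly inside both halves. *)
Let np_meet e f x : e \in A -> f \in A -> e <> f -> span L (nh e) x -> span L (ph f) x ->
  line L (nh e) x = line L (ph f) x ->
  share_foot L (nh e) (ph f) x \/ crossed_at f e x.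
Proof.
move=> /mixed [ne pe le] /mixed [nf pf _] nef se sf ll.
case: (dr_cross D (h := nh e) (k := ph f) nef se sf ll); first by left.
case=> c xe xf be bf; right; split=> //.
- by move=> fe; apply: nef.
- have nbe : x <> bx L e by move=> /be; rewrite -/(ph e) => h; rewrite h in pe; lra.
  move: se => /orP [] /andP [/= l1 l2]; last by lra.
  by rewrite !lt_neqAle l1 l2 !andbT; apply/andP; split; apply/eqP => // /esym.
- apply: span_inside => // /bf; rewrite /ph otherK => h.
  by rewrite -h in pf; lra.
Qed.

Let foot_inside h g : h.1 \in A -> g \in A -> inside g (vx L (foot L h)) ->
  line L (ph g) (vx L (foot L h)) <> vy L (foot L h).
Proof.
move=> hA gA ins; rewrite -(line_foot h D) => ll.
have sh : span L h (vx L (foot L h)) by rewrite /span lexx /= andbT le_total.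
have sg := inside_span ins.
have [gh|ngh] := pselect ((ph g).1 = h.1).
  have [hg|hg] := same_edge gh; first by apply: (inside_foot ins); rewrite hg.
  apply: (inside_bend ins); rewrite hg in ll sh sg *.
  exact: (dr_bend_other D sg sh ll).
case: (dr_cross D ngh sg sh ll) => [[_ e]|[_ _ e _ _]] //.
exact: inside_foot ins e.
Qed.

Definition hits (G : {set E}) := [set e in A | [exists f in G, crosses f e]].

(** * Cutting the falling halves at their first spine *)

Section Spines.
Variable G : {set E}.
Hypothesis GA : G \subset A.

Let E' : finType := {e : E | e \in hits G}.
Let S : finType := {f : E | f \in G}.

Let EA (e : E') : val e \in A.
Proof. by have := valP e; rewrite inE => /andP []. Qed.

Let SA (f : S) : val f \in A.
Proof. exact: (fintype.subsetP GA) (valP f). Qed.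

(** The falling half runs to the right from its foot, so the first spine on it has the least
    abscissa. *)
Let spine_ex (e : E') : exists f : S, crosses (val f) (val e) /\
  forall g : S, crosses (val g) (val e) -> ix (val f) (val e) <= ix (val g) (val e).
Proof.
have := valP e; rewrite inE => /andP [_ /existsP [f0 /andP [f0G cf0]]].
have [f cf min] := @arg_minP _ R S (exist _ f0 f0G) (fun f => crosses (val f) (val e))
  (fun f => ix (val f) (val e)) cf0.
by exists f.
Qed.

Let sp (e : E') : S := projT1 (cid (spine_ex e)).
Let p (e : E') := ix (val (sp e)) (val e).

Let spP e : crossed_at (val (sp e)) (val e) (p e).
Proof. by apply: ixP; have [] := projT2 (cid (spine_ex e)). Qed.

Let sp_min e (g : S) : crosses (val g) (val e) -> p e <= ix (val g) (val e).
Proof. by have [_] := projT2 (cid (spine_ex e)); apply. Qed.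

(* All the arcs which follow the spine [f] end at the abscissa [top_x f], which is
   to the right of all crossings on [f] but still inside the segment. *)
Definition top_x (f : E) := \big[Num.max/Num.min (vx L (foot L (ph f))) (bx L f)]_(e | crosses f e) ix f e.

Let top_ge f e : crosses f e -> ix f e <= top_x f.
Proof. by move=> c; rewrite /top_x; apply: le_bigmax_cond. Qed.

Let p_top e : p e <= top_x (val (sp e)).
Proof. by apply: top_ge; have [] := projT2 (cid (spine_ex e)). Qed.

Let top_lt f : top_x f < Num.max (vx L (foot L (ph f))) (bx L f).
Proof.
apply: bigmax_lt => [|e c]; last by have [_ _ /andP []] := ixP c.
have := dr_vert D (h := ph f); rewrite /= lt_max !gt_min !ltxx orbF /=.
by case: ltgtP => // ->.
Qed.

Let sp_inside e x : p e <= x -> x <= top_x (val (sp e)) -> inside (val (sp e)) x.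
Proof.
move=> l1 l2; have [_ _ /andP [i1 _] _ _] := spP e.
by rewrite /inside (lt_le_trans i1 l1) (le_lt_trans l2 (top_lt _)).
Qed.

Let top_inside e : inside (val (sp e)) (top_x (val (sp e))).
Proof. by apply: sp_inside => //; apply: p_top. Qed.

(** The vertices of the auxiliary graph: those of the drawing, and for each spine its point at
    [top_x]. The arc of [e] follows the falling half up to [p e] and then the spine. *)
Let T : finType := (V + S)%type.
Let px (w : T) := match w with inl v => vx L v | inr f => top_x (val f) end.
Let py (w : T) := match w with
  | inl v => vy L v | inr f => line L (ph (val f)) (top_x (val f)) end.
Let l (e : E') : T := inl (foot L (nh (val e))).
Let r (e : E') : T := inr (sp e).
Let F (e : E') := bent (p e) (line L (nh (val e)) (p e)) (slope L (nh (val e)))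
   (slope L (ph (val (sp e)))).

Let lp e : px (l e) < p e < bx L (val e).
Proof. by have [_ h _ _ _] := spP e. Qed.

Let Fl e x : x <= p e -> F e x = line L (nh (val e)) x.
Proof. by move=> h; rewrite /F /bent h /line; ring. Qed.

Let Fr e x : p e <= x -> F e x = line L (ph (val (sp e))) x.
Proof.
move=> h; have [_ _ _ ll _] := spP e; rewrite /F /bent; case: ifP => h'.
  have -> : x = p e by apply/le_anti; rewrite h h'.
  by rewrite subrr mulr0 addr0.
by rewrite ll /line; ring.
Qed.

Let nspan e x : px (l e) <= x -> x <= p e -> span L (nh (val e)) x.
Proof.
move=> h1 h2; apply/orP; left; have /andP [_ h3] := lp e.
by rewrite h1 /=; apply: le_trans h2 (ltW h3).
Qed.

(** By the choice of the first spine nothing is met before [p e]; at [p e] a second spine would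
    cross the first one, but positive halves do not cross. *)
Let stub_meet e (g : S) x : px (l e) < x -> x <= p e -> inside (val g) x ->
  line L (nh (val e)) x = line L (ph (val g)) x -> x = p e /\ g = sp e.
Proof.
move=> l1 l2 ins ll; have /andP [l3 l4] := lp e.
have se := nspan (ltW l1) l2; have sg := inside_span ins.
have [eg|neg] := pselect (val e = val g).
  rewrite -eg in ll sg; have := dr_bend_other D se sg ll.
  by rewrite /= => h; move: l4; rewrite -h ltNge l2.
case: (np_meet (EA e) (SA g) neg se sg ll) => [[_ h]|c].
  by move: l1; rewrite h ltxx.
have [cr ixx] := ixE (EA e) (SA g) c.
have xp : x = p e by apply/le_anti; rewrite l2 -ixx sp_min.
split=> //; apply: val_inj; apply: contrapT => ng.
have [_ _ ins' ll' _] := spP e; rewrite xp in ll ins sg.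
case: (pfree (SA g) (SA (sp e)) ng sg (inside_span ins')).
  by rewrite -ll.
by move=> _ /(inside_foot ins).
Qed.

Let top_meet e (g : S) x : p e <= x -> x <= top_x (val (sp e)) -> inside (val g) x ->
  line L (ph (val (sp e))) x = line L (ph (val g)) x -> g = sp e.
Proof.
move=> l1 l2 ins ll; apply: val_inj; apply: contrapT => ng.
have ins' := sp_inside l1 l2.
case: (pfree (SA g) (SA (sp e)) ng (inside_span ins) (inside_span ins') (esym ll)).
by move=> _ /(inside_foot ins).
Qed.

Let arcs : plane_arcs px py l r F.
Proof.
split.
- move=> e; have /andP [h _] := lp e; exact: lt_le_trans h (p_top e).
- by move=> e; have /andP [h _] := lp e; rewrite Fl ?(ltW h) //= line_foot.
- by move=> e; rewrite Fr ?p_top.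
- move=> e f v w [] -> [] -> /=.
  + by move=> h1 h2; congr inl; apply: (dr_inj D).
  + move=> h1 h2; exfalso.
    apply: (@foot_inside (nh (val e)) (val (sp f)) (EA e) (SA (sp f))); by rewrite h1 ?h2.
  + move=> h1 h2; exfalso.
    apply: (@foot_inside (nh (val f)) (val (sp e)) (EA f) (SA (sp e))); by rewrite -h1.
  + move=> h1 h2; congr inr; apply/esym.
    apply: (@top_meet e (sp f) (top_x (val (sp e)))) => //.
    + by rewrite h1; apply: top_inside.
    + by rewrite h2 h1.
- move=> e f; case: (pselect (e = f)) => [->|nef]; first by left.
  have [sef|nsef] := pselect (sp e = sp f).
    have [_ _ _ le pe] := spP e; have [_ _ _ lf pf] := spP f.
    have [_ sp0 _] := mixed (SA (sp e)).
    have [ne0 _ _] := mixed (EA e).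
    (* Two arcs with the same spine start as parallel stubs, both perpendicular to it. The arc that
       joins the spine earlier is the lower one, and afterwards they merge. *)
    have key e1 f1 : slope L (nh (val e1)) = slope L (nh (val f1)) ->
        slope L (nh (val e1)) < 0 -> 0 < slope L (ph (val (sp e1))) ->
        sp e1 = sp f1 -> p e1 <= p f1 -> forall x, F e1 x <= F f1 x.
      move=> es n1 p1 e12 lep x.
      have [_ _ _ l1 _] := spP e1; have [_ _ _ l2 _] := spP f1.
      rewrite /F /bent l1 l2 -es -e12 /line; move: n1 p1 lep.
      set a := slope L _; set b := slope L _; set u := p e1; set v := p f1.
      move=> n1 p1 lep; case: (leP x u) => xu; case: (leP x v) => xv.
      * have : 0 <= (b - a) * (v - u) by apply: mulr_ge0; lra.
        by lra.
      * by lra.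
      * have : 0 <= (b - a) * (v - x) by apply: mulr_ge0; lra.
        by lra.
      * by lra.
    have ss : slope L (nh (val e)) = slope L (nh (val f)).
      have b0 : slope L (ph (val (sp e))) != 0 by rewrite gt_eqF.
      by apply: (mulIf b0); rewrite pe sef pf.
    have [lep|lep] := leP (p e) (p f); [left|right] => x _ _; apply: key => //.
    + by rewrite -ss.
    + by rewrite -sef.
    + exact: ltW.
  have [||||] := @continuous_total R (F e) (F f) (px (l e)) (px (r e))
     (px (l f)) (px (r f)).
  + exact: bent_continuous.
  + exact: bent_continuous.
  + move=> x /andP [e1 e2] /andP [f1 f2] eqF.
    have nval : val e <> val f by move=> /val_inj.
    case: (leP x (p e)) => xe; case: (leP x (p f)) => xf.
    * rewrite (Fl xe) (Fl xf) in eqF.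
      case: (nfree (EA e) (EA f) nval (nspan (ltW e1) xe) (nspan (ltW f1) xf) eqF).
      by move=> _ h; move: e1; rewrite h ltxx.
    * rewrite (Fl xe) (Fr (ltW xf)) in eqF.
      by have [_ h] := stub_meet e1 xe (sp_inside (ltW xf) (ltW f2)) eqF; apply: nsef.
    * rewrite (Fl xf) (Fr (ltW xe)) in eqF.
      have [_ h] := stub_meet f1 xf (sp_inside (ltW xe) (ltW e2)) (esym eqF).
      by apply: nsef.
    * rewrite (Fr (ltW xf)) (Fr (ltW xe)) in eqF; apply: nsef; apply/esym.
      by apply: (@top_meet e (sp f) x); rewrite ?ltW //; apply: sp_inside; exact: ltW.
  + by left.
  + by move=> H; right=> x dt ds; apply: H.
- move=> e f w hw /andP [e1 e2]; case: (leP (px w) (p e)) => xe.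
    rewrite (Fl xe); case: hw e1 e2 xe => -> /= e1 e2 xe ll.
      have [ef|nef] := pselect (val e = val f); first by move: e1; rewrite ef ltxx.
      have sf : span L (nh (val f)) (vx L (foot L (nh (val f)))).
        by rewrite /span lexx /= andbT le_total.
      rewrite -(line_foot _ D) in ll.
      case: (nfree (EA e) (EA f) nef (nspan (ltW e1) xe) sf ll) => _ h.
      by move: e1; rewrite [X in _ < X]h ltxx.
    have [_ h] := stub_meet e1 xe (top_inside f) ll.
    by move: e2; rewrite h ltxx.
  rewrite (Fr (ltW xe)); case: hw e1 e2 xe => -> /= e1 e2 xe ll.
    apply: (@foot_inside (nh (val f)) (val (sp e)) (EA f) (SA (sp e))) ll.
    by apply: sp_inside; exact: ltW.
  have h := top_meet (ltW xe) (ltW e2) (top_inside f) ll.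
  by move: e2; rewrite h ltxx.
(* Two stubs from one foot perpendicular to one spine lie on the same line and overlap, against
   [nfree]. *)
- move=> e f [elf] [sef]; apply: contrapT => nef.
  have nval : val e <> val f by move=> /val_inj.
  have [_ _ _ le pe] := spP e; have [_ _ _ lf pf] := spP f.
  have [_ sp0 _] := mixed (SA (sp e)).
  have ss : slope L (nh (val e)) = slope L (nh (val f)).
    have b0 : slope L (ph (val (sp e))) != 0 by rewrite gt_eqF.
    by apply: (mulIf b0); rewrite pe sef pf.
  have /andP [e1 e2] := lp e; have /andP [f1 f2] := lp f.
  rewrite /= in e1 f1.
  have lle := line_foot (nh (val e)) D; have llf := line_foot (nh (val f)) D.
  have lines x : line L (nh (val e)) x = line L (nh (val f)) x.
    by move: lle llf; rewrite -elf /line -ss => h1 h2; lra.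
  have [lep|lep] := leP (p e) (p f).
    have [|||_ h] := @nfree (val e) (val f) (p e) (EA e) (EA f) nval.
    + by apply: nspan => //; exact: ltW.
    + by apply: nspan => //=; rewrite -elf; exact: ltW.
    + exact: lines.
    + by move: e1; rewrite [X in _ < X]h ltxx.
  have [|||_ h] := @nfree (val e) (val f) (p f) (EA e) (EA f) nval.
  + by apply: nspan => //=; [rewrite elf|]; exact: ltW.
  + by apply: nspan => //; exact: ltW.
  + exact: lines.
  + by move: f1; rewrite [X in _ < X]h elf ltxx.
Qed.

Lemma hits_card : (#|hits G| <= 3 * (#|V| + #|G|))%N.
Proof.
have -> : #|hits G| = #|E'| by rewrite card_sig; apply: eq_card => e; rewrite inE.
have -> : #|G| = #|S| by rewrite card_sig; apply: eq_card => e; rewrite inE.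
by rewrite -card_sum; apply: plane_arcs_card arcs.
Qed.

End Spines.

(** For a largest good [G], [hits_card] and [6 * #|G| <= #|hits G|] give [#|hits G| <= 6 * #|V|].
    The rest [U] has at most [11 * #|I|] edges with [I] plane, hence at most [11 * 13 * #|V|]; and
    143 + 6 = 149. *)
Lemma mixed_card : (#|A| <= 149 * #|V|)%N.
Proof.
pose good (G : {set E}) := (G \subset A) && (6 * #|G| <= #|hits G|)%N.
have good0 : good set0 by rewrite /good sub0set cards0 muln0.
have [G /andP [GA Gh] max] := @arg_maxP _ nat {set E} set0 good (fun G => #|G|) good0.
pose U := A :\: hits G.
have out f : f \in U -> (#|[set e in U | crosses f e]| <= 5)%N.
  rewrite inE => /andP [_ fA]; rewrite leqNgt; apply/negP => out.
  (* If [f] is in [G], the halves it crosses belong to [hits G], not to [U]. Otherwise six crossed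
     halves in [U] would allow adding [f] to [G]. *)
  have [fG|nfG] := boolP (f \in G).
    suff e0 : [set e in U | crosses f e] = set0 by rewrite e0 cards0 in out.
    apply/setP => e; rewrite !inE; apply/negP => /andP [/andP [nh eA] c].
    by move: nh; rewrite eA /= => /existsP []; exists f; rewrite fG.
  have gG : good (f |: G).
    apply/andP; split; first by rewrite subUset sub1set fA.
    rewrite cardsU1 nfG mulnDr muln1.
    apply: leq_trans (leq_add out Gh) _.
    rewrite -cardsUI.
    have -> : [set e in U | crosses f e] :&: hits G = set0.
      apply/setP => e; rewrite !inE; case: (e \in A) => /=; rewrite ?andbF //.
      by case: existsP => _ /=; rewrite ?andbF.
    rewrite cards0 addn0; apply/subset_leq_card/fintype.subsetP => e.
    rewrite !inE => /orP [/andP [/andP [_ eA] c]|/andP [eA /existsP [g /andP [gG c]]]].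
      by rewrite eA; apply/existsP; exists f; rewrite in_setU1 eqxx.
    by rewrite eA; apply/existsP; exists g; rewrite in_setU1 gG orbT.
  have : (#|f |: G| <= #|G|)%N := max _ gG.
  by rewrite cardsU1 nfG ltnn.
have [I [IU ind cI]] := independent_set out.
have AU e : e \in I -> e \in A by move=> /(fintype.subsetP IU); rewrite inE => /andP [].
(* Halves with slopes of the same sign never cross, and independence excludes the mixed
   crossings. *)
have pI : plane L I.
  move=> h k x hI kI nhk sh sk ll.
  have half (m : E * bool) : m = nh m.1 \/ m = ph m.1.
    by have [->|->] := @same_edge E (nh m.1) m (erefl _); [left|right].
  have nc e f y : e \in I -> f \in I -> e <> f -> ~ crossed_at f e y.
    move=> eI fI nef c; have [cr _] := ixE (AU _ eI) (AU _ fI) c.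
    by move: (ind f e fI eI (nesym nef)); rewrite cr.
  have hA := AU _ hI; have kA := AU _ kI.
  case: (half h) (half k) => eh [] ek; rewrite eh ek in sh sk ll *.
  - exact: nfree.
  - by case: (np_meet hA kA nhk sh sk ll) => // /nc [].
  - case: (np_meet kA hA (nesym nhk) sk sh (esym ll)) => [[h1 h2]|/(nc _ _ _ kI hI (nesym nhk))] //.
    by split=> //; rewrite h2 h1.
  - exact: pfree.
have := plane_card D pI; have := hits_card GA.
have := cardsID (hits G) A; rewrite -/U.
have := subset_leq_card (subsetIr A (hits G)).
move: Gh cI; move: #|I| #|U| #|V| #|G| #|hits G| #|A| #|A :&: hits G|.
clear; lia.
Qed.

End Mixed.

(** 324 = 13 + 13 + 149 + 149. Edges whose halves both fall, or both rise, cross nothing of their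
    own kind; mixed edges are split by the direction of the falling half, and a half-turn, which
    keeps slopes, exchanges the two directions. *)
Lemma drawing_card (R : realType) (V E : finType) (L : layout R V E) :
  drawing L -> (#|E| <= 324 * #|V|)%N.
Proof.
move=> D.
pose neg e b := slope L (e, b) < 0.
have pos h : ~~ (slope L h < 0) -> 0 < slope L h.
  by rewrite -leNgt lt_neqAle eq_sym => ->; rewrite andbT; apply/eqP/(dr_hor D).
pose left e := vx L (foot L (nh L e)) < bx L e.
pose A1 := [set e | neg e true && neg e false].
pose A2 := [set e | ~~ neg e true && ~~ neg e false].
pose A3 := [set e | (neg e true != neg e false) && left e].
pose A4 := [set e | (neg e true != neg e false) && ~~ left e].
have signs e : neg e true != neg e false -> slope L (nh L e) < 0 /\ 0 < slope L (ph L e).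
  rewrite /ph /nh /other /= -/(neg e true); case n1: (neg e true) => /= n2.
    by split=> //; apply: pos; rewrite -/(neg e false); case: (neg e false) n2.
  by split; [rewrite -/(neg e false); case: (neg e false) n2|apply: pos; rewrite -/(neg e true) n1].
have c1 : (#|A1| <= 13 * #|V|)%N.
  apply: (plane_card D) => -[e b] [f c] x; rewrite !inE /= => /andP [e1 e2] /andP [f1 f2].
  move=> nef se sf ll; case: (dr_cross D (h := (e, b)) (k := (f, c)) nef se sf ll) => // -[cr _ _ _ _].
  have ne : slope L (e, b) < 0 by case: b {se ll cr}.
  have nf : slope L (f, c) < 0 by case: c {sf ll cr}.
  have : 0 < slope L (e, b) * slope L (f, c) by rewrite nmulr_rgt0.
  by rewrite cr ltr0N1.
have c2 : (#|A2| <= 13 * #|V|)%N.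
  apply: (plane_card D) => -[e b] [f c] x; rewrite !inE /= => /andP [e1 e2] /andP [f1 f2].
  move=> nef se sf ll; case: (dr_cross D (h := (e, b)) (k := (f, c)) nef se sf ll) => // -[cr _ _ _ _].
  have ne : 0 < slope L (e, b) by apply: pos; case: b {se ll cr}.
  have nf : 0 < slope L (f, c) by apply: pos; case: c {sf ll cr}.
  by have := mulr_gt0 ne nf; rewrite cr ltr0N1.
have c3 : (#|A3| <= 149 * #|V|)%N.
  apply: (mixed_card D) => e; rewrite inE => /andP [/signs [s1 s2] le].
  by split.
have c4 : (#|A4| <= 149 * #|V|)%N.
  have m1 : (-1 : R) ^+ 2 = 1 by rewrite sqrrN expr1n.
  have sl h : slope (flip (-1) (-1) L) h = slope L h.
    by rewrite slope_flip // mulrNN !mul1r.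
  apply: (mixed_card (drawing_flip m1 m1 D)) => e; rewrite inE => /andP [/signs [s1 s2] le].
  rewrite /ph /nh !sl -/(nh L e) -/(ph L e); split=> //=.
  rewrite !mulN1r ltrN2 lt_neqAle leNgt le andbT eq_sym; apply/eqP.
  exact: (dr_vert D (h := nh L e)).
have cov : [set: E] \subset A1 :|: A2 :|: (A3 :|: A4).
  apply/fintype.subsetP => e _; rewrite !inE.
  by case: (neg e true); case: (neg e false); case: (left e).
have := subset_leq_card cov; rewrite cardsT.
have := (leq_card_setU (A1 :|: A2) (A3 :|: A4)).1.
have := (leq_card_setU A1 A2).1; have := (leq_card_setU A3 A4).1.
move: c1 c2 c3 c4; move: #|A1| #|A2| #|A3| #|A4| #|V| #|E| #|A1 :|: A2| #|A3 :|: A4|.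
move: #|A1 :|: A2 :|: (A3 :|: A4)|.
clear; lia.
Qed.

(** * From polygonal arcs to drawings in generic coordinates *)

Section Points.
Variable R : realType.
Implicit Types (a b c q : point R) (p : seq (point R)).

Lemma point_eq a b : a.1 = b.1 -> a.2 = b.2 -> a = b.
Proof. by case: a b => [? ?] [? ?] /= -> ->. Qed.

Lemma open_segment_ends a b q : a <> b -> in_open_segment a b q -> q <> a /\ q <> b.
Proof.
move=> nab [t [/andP [t0 t1] ->]].
have nt : t != 0 by rewrite gt_eqF.
have nt1 : 1 - t != 0 by rewrite subr_eq0 gt_eqF.
split=> e; have /= e1 := congr1 fst e; have /= e2 := congr1 snd e; apply/nab/point_eq.
- by apply: (mulfI nt); lra.
- by apply: (mulfI nt); lra.
- by apply: (mulfI nt1); lra.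
- by apply: (mulfI nt1); lra.
Qed.

Lemma in_segmentC a b q : in_segment a b q -> in_segment b a q.
Proof.
move=> [t [ht ->]]; exists (1 - t); split; first by lra.
by rewrite /segment_point; congr pair; ring.
Qed.

Definition midpoint a c : point R := segment_point a c (1 / 2).

Lemma half_segment a c q : in_segment a (midpoint a c) q ->
  exists t, [/\ 0 <= t <= 1 / 2 & q = segment_point a c t].
Proof.
move=> [t [ht ->]]; exists (t / 2); split; first by lra.
by rewrite /segment_point /=; congr pair; field.
Qed.

Lemma midpointC a c : midpoint a c = midpoint c a.
Proof. by rewrite /midpoint /segment_point; congr pair; field. Qed.

Definition bend_of a c (bends : seq (point R)) : point R := head (midpoint a c) bends.

(* An arc without bends is cut at its midpoint. *)
Definition half_arc p a b c := [/\ a <> b,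
  forall q, in_segment a b q -> on_arc p q,
  (forall q, in_segment a b q -> in_segment c b q -> q = b) &
  forall q j, in_segment a b q -> inside_side p j q ->
    (exists k, [/\ k != 0, (corner p j.+1).1 - (corner p j).1 = k * (b.1 - a.1) &
                           (corner p j.+1).2 - (corner p j).2 = k * (b.2 - a.2)]) /\
    q <> a /\ (q = b -> b.1 - a.1 = c.1 - b.1 /\ b.2 - a.2 = c.2 - b.2)].

Lemma one_bend_halves p a c bends : polygonal_arc p -> p = a :: rcons bends c ->
  (size bends <= 1)%N ->
  half_arc p a (bend_of a c bends) c /\ half_arc p c (bend_of a c bends) a.
Proof.
case: bends => [|b [|]] //= [sp cons simple _] ep _; rewrite /bend_of /=.
  have nac : a <> c by have := cons 0%N; rewrite ep; apply.
  have nth2 : forall d e : point R, d <> e -> d.1 != e.1 \/ d.2 != e.2.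
    move=> d e nde; case: (eqVneq d.1 e.1) => h1; last by left.
    by right; apply/eqP => h2; apply/nde/point_eq.
  have nmid d e : d <> e -> d <> midpoint d e.
    move=> nde h; have /= h1 := congr1 fst h; have /= h2 := congr1 snd h.
    by apply/nde/point_eq; lra.
  have meet d e q : d <> e -> in_segment d (midpoint d e) q ->
      in_segment e (midpoint d e) q -> q = midpoint d e.
    move=> nde /half_segment [s [s1 ->]]; rewrite midpointC.
    move=> /half_segment [t [t1 h]].
    have /= h1 := congr1 fst h; have /= h2 := congr1 snd h.
    have k1 : (s + t - 1) * (e.1 - d.1) = 0 by lra.
    have k2 : (s + t - 1) * (e.2 - d.2) = 0 by lra.
    have st : s + t - 1 = 0.
      case: (nth2 _ _ (nesym nde)); rewrite -subr_eq0 => nd; apply: (mulIf nd).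
        by rewrite k1 mul0r.
      by rewrite k2 mul0r.
    have -> : s = 1 / 2 by lra.
    by rewrite midpointC.
  have arc0 q : in_segment a (midpoint a c) q -> on_arc p q.
    move=> /half_segment [t [ht ->]]; exists 0%N; rewrite ep; split=> //.
    by exists t; split=> //; lra.
  have arc1 q : in_segment c (midpoint a c) q -> on_arc p q.
    rewrite midpointC => /half_segment [t [ht ->]]; exists 0%N; rewrite ep; split=> //.
    by apply: in_segmentC; exists t; split=> //; lra.
  have ncc : c <> midpoint a c by rewrite midpointC; apply: nmid; apply: nesym.
  split; split=> //.
  - exact: nmid.
  - by move=> q; apply: meet.
  - move=> q j _ [sj]; move: sj; rewrite ep /=; case: j => // _ op.
    split; last by split=> [|_ /=]; [have [] := open_segment_ends nac op|split; lra].
    by exists 2; rewrite /corner /=; split; [rewrite pnatr_eq0|lra|lra].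
  - by move=> q h1 h2; apply: meet.
  - move=> q j _ [sj]; move: sj; rewrite ep /=; case: j => // _ op.
    split; last by split=> [|_ /=]; [have [] := open_segment_ends nac op|split; lra].
    by exists (-2); rewrite /corner /=; split; [rewrite oppr_eq0 pnatr_eq0|lra|lra].
have nab : a <> b by have := cons 0%N; rewrite ep; apply.
have nbc : b <> c by have := cons 1%N; rewrite ep; apply.
have side0 q : in_segment a b q -> on_side p 0 q by move=> h; rewrite ep; split.
have side1 q : in_segment c b q -> on_side p 1 q.
  by move=> h; rewrite ep; split=> //=; apply: in_segmentC.
have meet q : in_segment a b q -> in_segment c b q -> q = b.
  move=> /side0 h0 /side1 h1; have [_ ->] := simple 0%N 1%N q isT h0 h1.
  by rewrite ep.
have in0 q : in_open_segment a b q -> in_segment a b q.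
  by move=> [t [ht ->]]; exists t; split=> //; lra.
have in1 q : in_open_segment b c q -> in_segment c b q.
  by move=> [t [ht ->]]; apply: in_segmentC; exists t; split=> //; lra.
split; split=> //.
- by move=> q /side0; exists 0%N.
- move=> q j sq [sj]; move: sj; rewrite ep /=; case: j => [|[|]] // _ op.
    split; first by exists 1; rewrite oner_eq0 !mul1r.
    by have [] := open_segment_ends nab op.
  have [qb _] := open_segment_ends nbc op.
  by case: qb; apply: meet => //; apply: in1.
- exact: nesym.
- by move=> q /side1; exists 1%N.
- by move=> q h1 h2; apply: meet.
- move=> q j sq [sj]; move: sj; rewrite ep /=; case: j => [|[|]] // _ op.
    have [_ qb] := open_segment_ends nab op.
    by case: qb; apply: meet => //; apply: in0.
  split; first by exists (-1); rewrite oppr_eq0 oner_eq0 /corner /=; split=> //; ring.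
  by have [] := open_segment_ends nbc op.
Qed.

(** Each vector [d] rules out at most two values of [t], namely [- d.1 / d.2] and [d.2 / d.1]. The
    witness exceeds all their absolute values. *)
Lemma generic_direction (I : finType) (d : I -> point R) :
  (forall i, d i <> (0, 0)) ->
  exists t, forall i, (d i).1 + t * (d i).2 != 0 /\ (d i).2 - t * (d i).1 != 0.
Proof.
move=> nd; pose m i := `|(d i).1 / (d i).2| + `|(d i).2 / (d i).1|.
pose t := 1 + \sum_i m i; exists t => i.
have m_ge0 j : 0 <= m j by rewrite addr_ge0.
have lt : m i < t.
  rewrite /t (bigD1 i) //= addrA addrAC -[ltLHS]add0r ltrD2r //.
  by rewrite ltr_pwDl // sumr_ge0.
have [l1 l2] : - ((d i).1 / (d i).2) < t /\ (d i).2 / (d i).1 < t.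
  by split; apply: le_lt_trans lt; rewrite /m;
    [have := ler_norm (- ((d i).1 / (d i).2)); rewrite normrN|have := ler_norm ((d i).2 / (d i).1)] => h;
    have := normr_ge0 ((d i).1 / (d i).2); have := normr_ge0 ((d i).2 / (d i).1); lra.
split; apply/eqP => h.
  case: (eqVneq (d i).2 0) => [d2|d2].
    by apply: (nd i); apply: point_eq => //=; rewrite d2 mulr0 addr0 in h.
  have e : t = - ((d i).1 / (d i).2) by apply: (mulIf d2); rewrite mulNr divfK //; lra.
  by rewrite e ltxx in l1.
case: (eqVneq (d i).1 0) => [d1|d1].
  by apply: (nd i); apply: point_eq => //=; rewrite d1 mulr0 subr0 in h.
have e : t = (d i).2 / (d i).1 by apply: (mulIf d1); rewrite divfK //; lra.
by rewrite e ltxx in l2.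
Qed.

End Points.

Section Coordinates.
Variables (R : realType) (G : sgraph).
Variables (pos : vertex G -> point R) (arc : {set vertex G} -> seq (point R)).
Hypothesis pos_inj : injective pos.

Let E : finType := {e : {set vertex G} | e \in edges G}.

Variable ends : E -> vertex G * vertex G * seq (point R).
Hypothesis endsP : forall e : E, [/\ val e = [set (ends e).1.1; (ends e).1.2],
  arc (val e) = pos (ends e).1.1 :: rcons (ends e).2 (pos (ends e).1.2) &
  (size (ends e).2 <= 1)%N].
Hypothesis arc_poly : forall e : E, polygonal_arc (arc (val e)).
Hypothesis arc_cross : forall e f : E, e <> f -> forall q,
  on_arc (arc (val e)) q -> on_arc (arc (val f)) q ->
  (exists2 w, w \in val e :&: val f & q = pos w) \/
  right_angle_crossing (arc (val e)) (arc (val f)) q.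

Let ft (h : E * bool) := if h.2 then (ends h.1).1.1 else (ends h.1).1.2.
Let bd (e : E) := bend_of (pos (ends e).1.1) (pos (ends e).1.2) (ends e).2.

Let halves (h : E * bool) : half_arc (arc (val h.1)) (pos (ft h)) (bd h.1) (pos (ft (other h))).
Proof.
have [_ ea sz] := endsP h.1.
have [h1 h2] := one_bend_halves (arc_poly h.1) ea sz.
by case: h ea sz h1 h2 => e [].
Qed.

Let ends_neq e : ft (e, true) <> ft (e, false).
Proof.
rewrite /ft /= => eq; have := valP e; have [-> _ _] := endsP e.
rewrite /= eq setUid inE => /existsP [x /existsP [y /andP [xy /eqP exy]]].
have : #|[set (ends e).1.2]| = #|[set x; y]| by rewrite exy.
rewrite cards1 cards2; case: eqP => // e1; by rewrite e1 adj_irrefl in xy.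
Qed.

Let val_ends (h : E * bool) : val h.1 = [set ft h; ft (other h)].
Proof. by have [-> _ _] := endsP h.1; case: h => e [] //=; rewrite setUC. Qed.

Section Slant.
Variable t : R.
Hypothesis tP : forall h,
  ((bd h.1).1 - (pos (ft h)).1) + t * ((bd h.1).2 - (pos (ft h)).2) != 0 /\
  ((bd h.1).2 - (pos (ft h)).2) - t * ((bd h.1).1 - (pos (ft h)).1) != 0.

(** [(X, Y)] is a rotation followed by a scaling, so it keeps right angles; by [tP] no half is
    parallel to an axis in these coordinates. *)
Let X (q : point R) := q.1 + t * q.2.
Let Y (q : point R) := q.2 - t * q.1.

Let XY_inj q q' : X q = X q' -> Y q = Y q' -> q = q'.
Proof.
rewrite /X /Y => eX eY.
have t2 : 1 + t * t != 0.
  by rewrite gt_eqF // ltr_pwDl // -expr2 sqr_ge0.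
apply: point_eq; apply: (mulfI t2).
  have -> : (1 + t * t) * q.1 = (q.1 + t * q.2) - t * (q.2 - t * q.1) by ring.
  by rewrite eX eY; ring.
have -> : (1 + t * t) * q.2 = (q.2 - t * q.1) + t * (q.1 + t * q.2) by ring.
by rewrite eX eY; ring.
Qed.

Let L : layout R (vertex G) E :=
  Layout ft (X \o pos) (Y \o pos) (X \o bd) (Y \o bd).

Let dX h : X (bd h.1) - X (pos (ft h)) =
  ((bd h.1).1 - (pos (ft h)).1) + t * ((bd h.1).2 - (pos (ft h)).2).
Proof. by rewrite /X; ring. Qed.

Let dY h : Y (bd h.1) - Y (pos (ft h)) =
  ((bd h.1).2 - (pos (ft h)).2) - t * ((bd h.1).1 - (pos (ft h)).1).
Proof. by rewrite /Y; ring. Qed.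

Let dX0 h : X (bd h.1) - X (pos (ft h)) != 0.
Proof. by rewrite dX; have [] := tP h. Qed.

Let dY0 h : Y (bd h.1) - Y (pos (ft h)) != 0.
Proof. by rewrite dY; have [] := tP h. Qed.

Let span_point h x : span L h x ->
  exists q, [/\ in_segment (pos (ft h)) (bd h.1) q, X q = x & Y q = line L h x].
Proof.
move=> sx; pose s := (x - X (pos (ft h))) / (X (bd h.1) - X (pos (ft h))).
have sK : s * (X (bd h.1) - X (pos (ft h))) = x - X (pos (ft h)) by rewrite divfK.
have s01 : 0 <= s <= 1.
  have := dX0 h; rewrite neq_lt subr_lt0 subr_gt0 /s.
  case/orP: sx => /= /andP [h1 h2] /orP [h3|h3]; try by lra.
    by rewrite ler_pdivlMr ?subr_gt0 // mul0r ler_pdivrMr ?subr_gt0 // mul1r; lra.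
  by rewrite ler_ndivlMr ?subr_lt0 // mul0r ler_ndivrMr ?subr_lt0 // mul1r; lra.
exists (segment_point (pos (ft h)) (bd h.1) s); split; first by exists s.
  by rewrite -[RHS](subrK (X (pos (ft h)))) -sK /X /segment_point /=; ring.
rewrite /line /slope /=.
have -> : x - X (bd h.1) = (s - 1) * (X (bd h.1) - X (pos (ft h))).
  by rewrite mulrBl sK mul1r; ring.
rewrite mulrCA divfK //.
by rewrite /Y /segment_point /=; ring.
Qed.

Let common h k x : span L h x -> span L k x -> line L h x = line L k x ->
  exists q, [/\ in_segment (pos (ft h)) (bd h.1) q,
    in_segment (pos (ft k)) (bd k.1) q, X q = x & Y q = line L h x].
Proof.
move=> /span_point [q [sq Xq Yq]] /span_point [q' [sq' Xq' Yq']] ll.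
exists q; split=> //; suff -> : q = q' by [].
by apply: XY_inj; rewrite ?Xq ?Xq' ?Yq ?Yq'.
Qed.

Let foot_of (h : E * bool) w : w \in val h.1 -> in_segment (pos (ft h)) (bd h.1) (pos w) ->
  w = ft h.
Proof.
rewrite val_ends !inE => /orP [/eqP //|/eqP ->] seg.
have [_ _ meet _] := halves h; have [nb _ _ _] := halves (other h).
case: nb; apply: meet => //.
by exists 0; rewrite lexx ler01; split=> //; rewrite /segment_point; apply: point_eq; rewrite /= subr0 mul1r mul0r addr0.
Qed.

Lemma coordinate_drawing : drawing L.
Proof.
split=> /=.
- by move=> v w h1 h2; apply/pos_inj/XY_inj.
- exact: ends_neq.
- by move=> h k e1 e2; apply: val_inj; rewrite !val_ends e1 e2.
- by move=> h e; have := dX0 h; rewrite e subrr eqxx.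
- by move=> h; apply/eqP/mulf_neq0; [exact: dY0|rewrite invr_neq0 // dX0].
- move=> e x s1 s2 ll; have [q [i1 i2 <- _]] := common s1 s2 ll.
  by have [_ _ meet _] := halves (e, true); rewrite (meet q).
move=> h k x nhk sh sk ll; have [q [ih ik qx qy]] := common sh sk ll.
have [nh ah _ dh] := halves h; have [nk ak _ dk] := halves k.
case: (arc_cross nhk (ah _ ih) (ak _ ik)) => [[w]|[i [j [si sj perp]]]].
  rewrite inE => /andP [wh wk] qw; left.
  rewrite qw in ih ik; have := foot_of wh ih; have := foot_of wk ik.
  by move=> ek eh; split=> /=; [rewrite -eh -ek|rewrite -eh -qx qw].
right; have [[m [m0 m1 m2]] [qh bh]] := dh q i ih si; have [[n [n0 n1 n2]] [qk bk]] := dk q j ik sj.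
have dot : ((bd h.1).1 - (pos (ft h)).1) * ((bd k.1).1 - (pos (ft k)).1) +
    ((bd h.1).2 - (pos (ft h)).2) * ((bd k.1).2 - (pos (ft k)).2) = 0.
  move: perp; rewrite /perpendicular m1 m2 n1 n2 => perp.
  apply: (mulfI (mulf_neq0 m0 n0)); rewrite mulr0 -perp; ring.
have at_foot h' : line L h' (X (pos (ft h'))) = Y (pos (ft h')).
  by rewrite /line /slope /= -[X (pos (ft h')) - X (bd h'.1)]opprB mulrN divfK ?subKr.
have at_bend h' : line L h' (X (bd h'.1)) = Y (bd h'.1).
  by rewrite /line /= subrr mulr0 addr0.
have straight h' : (bd h'.1).1 - (pos (ft h')).1 = (pos (ft (other h'))).1 - (bd h'.1).1 /\
    (bd h'.1).2 - (pos (ft h')).2 = (pos (ft (other h'))).2 - (bd h'.1).2 ->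
    slope L (other h') = slope L h'.
  move=> [e1 e2]; rewrite /slope /=.
  have -> : Y (bd h'.1) - Y (pos (ft (other h'))) = - (Y (bd h'.1) - Y (pos (ft h'))).
    have : t * ((bd h'.1).1 - (pos (ft h')).1) = t * ((pos (ft (other h'))).1 - (bd h'.1).1).
      by rewrite e1.
    by rewrite /Y; lra.
  have -> : X (bd h'.1) - X (pos (ft (other h'))) = - (X (bd h'.1) - X (pos (ft h'))).
    have : t * ((bd h'.1).2 - (pos (ft h')).2) = t * ((pos (ft (other h'))).2 - (bd h'.1).2).
      by rewrite e2.
    by rewrite /X; lra.
  by rewrite invrN mulrNN.
split=> /=.
- have sE h' : (X (bd h'.1) - X (pos (ft h'))) * slope L h' = Y (bd h'.1) - Y (pos (ft h')).
    by rewrite /slope /= mulrC divfK.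
  (* With denominators cleared, the claim is that the inner product of the two halves vanishes in
     the new coordinates, where it is [1 + t * t] times the old one. *)
  apply: (mulfI (mulf_neq0 (dX0 h) (dX0 k))); rewrite mulrACA !sE mulrN1 !dX !dY.
  move: dot; set u1 := _ - _; set v1 := _ - _; set u2 := _ - _; set v2 := _ - _ => dot.
  have tdot : (1 + t * t) * (u1 * v1 + u2 * v2) = 0 by rewrite dot mulr0.
  by rewrite -[LHS]subr0 -tdot; ring.
- by move=> xf; apply: qh; apply: XY_inj; rewrite ?qx ?qy // xf at_foot.
- by move=> xf; apply: qk; apply: XY_inj; rewrite ?qx ?qy // ll xf at_foot.
- by move=> xb; apply/straight/bh; apply: XY_inj; rewrite ?qx ?qy // xb at_bend.
- by move=> xb; apply/straight/bk; apply: XY_inj; rewrite ?qx ?qy // ll xb at_bend.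
Qed.

End Slant.

Lemma coordinate_card : (#|edges G| <= 324 * #|vertex G|)%N.
Proof.
pose d (h : E * bool) : point R :=
  ((bd h.1).1 - (pos (ft h)).1, (bd h.1).2 - (pos (ft h)).2).
have [h|t tP] := @generic_direction R (E * bool)%type d.
  have [nb _ _ _] := halves h; case=> /eqP; rewrite subr_eq0 => /eqP e1 /eqP.
  by rewrite subr_eq0 => /eqP e2; apply/nb/point_eq.
have -> : #|edges G| = #|E| by rewrite card_sig; apply: eq_card => e; rewrite inE.
exact: (drawing_card (coordinate_drawing tP)).
Qed.

End Coordinates.

Lemma one_bend_card (R : realType) (G : sgraph) :
  in_class R 1 G -> (#|edges G| <= 324 * #|vertex G|)%N.
Proof.
move=> [pos [arc [pos_inj arcP cross]]].
pose E : finType := {e : {set vertex G} | e \in edges G}.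
have [ends endsP] : {ends : E -> vertex G * vertex G * seq (point R) & forall e : E,
    [/\ val e = [set (ends e).1.1; (ends e).1.2],
      arc (val e) = pos (ends e).1.1 :: rcons (ends e).2 (pos (ends e).1.2) &
      (size (ends e).2 <= 1)%N]}.
  apply: (@choice E (vertex G * vertex G * seq (point R))%type (fun e o =>
    [/\ val e = [set o.1.1; o.1.2],
      arc (val e) = pos o.1.1 :: rcons o.2 (pos o.1.2) & (size o.2 <= 1)%N])) => e.
  by have [_ [u [v [bs h]]]] := arcP _ (valP e); exists (u, v, bs).
apply: (coordinate_card pos_inj endsP) => [e|e f nef q h1 h2].
  by have [] := arcP _ (valP e).
by apply: cross h1 h2; [exact: valP|exact: valP|move=> /val_inj].
Qed.

(** * One-bend drawings of the complete bipartite graphs K(3, n) *)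

Section CompleteBipartite.
Variable n : nat.

(** [option bool] serves as the set of the three hubs. *)
Let V : finType := (option bool + 'I_n)%type.

Definition joined : rel V := fun x y =>
  match x, y with inl _, inr _ | inr _, inl _ => true | _, _ => false end.

Lemma joined_sym : symmetric joined. Proof. by move=> [x|x] [y|y]. Qed.
Lemma joined_irrefl : irreflexive joined. Proof. by move=> [x|x]. Qed.

Definition K3 : sgraph := SGraph joined_sym joined_irrefl.

Definition spoke (i : option bool) (j : 'I_n) : {set vertex K3} := [set inl i; inr j].

Lemma spoke_edge i j : spoke i j \in edges K3.
Proof.
by rewrite inE; apply/existsP; exists (inl i); apply/existsP; exists (inr j); rewrite /= eqxx.
Qed.

Lemma edge_spoke e : e \in edges K3 -> exists i j, e = spoke i j.
Proof.
rewrite inE => /existsP [[i|j] /existsP [[i'|j'] /andP [] //= _ /eqP ->]].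
  by exists i, j'.
by exists i', j; rewrite /spoke setUC.
Qed.

Lemma in_spoke w i j : (w \in spoke i j) = (w == inl i) || (w == inr j).
Proof. by rewrite !inE. Qed.

Lemma spoke_inj i j i' j' : spoke i j = spoke i' j' -> i = i' /\ j = j'.
Proof.
move=> e; have : inl i \in spoke i' j' by rewrite -e in_spoke eqxx.
have : inr j \in spoke i' j' by rewrite -e in_spoke eqxx orbT.
by rewrite !in_spoke /= orbF => /eqP [->] /eqP [->].
Qed.

Lemma card_K3 : #|vertex K3| = (3 + n)%N.
Proof. by rewrite card_sum card_option card_bool card_ord. Qed.

End CompleteBipartite.

(** * The drawing with one bend on each edge *)

Section OneBendDrawing.
Variables (R : realType) (n : nat).

(** The shift by one gives [1 <= c j] and [c j + 1 <= m]: the leaves lie below the horizontal axis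
    and strictly between the bends on the lines of abscissa 0 and [m]. *)
Let c (j : 'I_n) : R := j.+1%:R.
Let m : R := n.+1%:R.

Definition hub_pt (i : option bool) : point R :=
  match i with None => (0, 1) | Some false => (-1, 0) | Some true => (m + 1, 0) end.
Definition leaf_pt (j : 'I_n) : point R := (c j, - c j).
Definition bend_pt (i : option bool) (j : 'I_n) : point R :=
  match i with None => (c j, 0) | Some false => (0, - c j) | Some true => (m, - c j) end.

Definition K3_pos (v : vertex (K3 n)) : point R :=
  match v with inl i => hub_pt i | inr j => leaf_pt j end.
Definition spoke_path i j : seq (point R) := [:: hub_pt i; bend_pt i j; leaf_pt j].
(** The empty sequence is a dummy for sets that are not edges. *)
Definition K3_arc (e : {set vertex (K3 n)}) : seq (point R) :=
  if [pick ij : option bool * 'I_n | e == spoke ij.1 ij.2] is Some ij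
  then spoke_path ij.1 ij.2 else [::].

Let c1 j : 1 <= c j. Proof. by rewrite ler1n. Qed.
Let cm j : c j + 1 <= m. Proof. by rewrite /m -[n.+1%:R]natr1 lerD2r ler_nat. Qed.
Let cI j k : c j = c k -> j = k.
Proof. by move=> /eqP; rewrite eqr_nat eqSS => /eqP /val_inj. Qed.

Lemma K3_arcE i j : K3_arc (spoke i j) = spoke_path i j.
Proof.
rewrite /K3_arc; case: pickP => [[i' j'] /= /eqP /spoke_inj [-> ->] //|].
by move=> /(_ (i, j)); rewrite /= eqxx.
Qed.

Lemma K3_pos_inj : injective K3_pos.
Proof.
have h : forall i j, hub_pt i <> leaf_pt j.
  move=> i j; have := c1 j; have := cm j.
  by case: i => [[]|] h1 h2 [] /= e1 e2; apply: (@absurd_le R); lra.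
move=> [i|j] [i'|j'] /= e; try by [case: (h i j')|case: (h i' j); rewrite e].
  have m1 : 1 <= m by rewrite ler1n.
  have e1 := congr1 fst e; have e2 := congr1 snd e; congr inl.
  by case: i i' e1 e2 {e} => [[]|] [[]|] //= e1 e2; apply: (@absurd_le R); lra.
by congr inr; apply: cI; case: e.
Qed.

Lemma on_path i j q : on_arc (spoke_path i j) q ->
  in_segment (hub_pt i) (bend_pt i j) q \/ in_segment (bend_pt i j) (leaf_pt j) q.
Proof. by move=> [[|[|k]] [] // _ h]; [left|right]. Qed.

Lemma path_polygonal i j : polygonal_arc (spoke_path i j).
Proof.
have h1 := c1 j; have h2 := cm j.
have mulc t : 0 <= t -> 0 <= t * c j by move=> t0; apply: mulr_ge0; lra.
have mulm t : 0 <= t -> 0 <= t * (m - c j) by move=> t0; apply: mulr_ge0; lra.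
split=> //.
- move=> k sk e; have e1 := congr1 fst e; have e2 := congr1 snd e; move: sk e1 e2.
  by case: i {e} => [[]|]; case: k => [|[|k]] //= _; rewrite /corner /= => e1 e2;
    apply: (@absurd_le R); lra.
- move=> a b x ab [sa ina] [sb inb].
  case: a b ab sa ina sb inb => [|a] [|[|b]] // _ _ [t [t01 ->]] _ [s [s01 e]].
  have e1 := congr1 fst e; have e2 := congr1 snd e; move: e1 e2 {e}.
  have s0 : 0 <= s by lra.
  have sc := mulc _ s0; have sm := mulm _ s0.
  rewrite /corner /segment_point; case: i => [[]|] /= e1 e2;
    have t1 : t = 1 by [lra]; split=> //; apply: point_eq => /=; rewrite t1; ring.
- have cc : 0 < c j * c j by apply: mulr_gt0; lra.
  have cmc : 0 < c j * (m - c j) by apply: mulr_gt0; lra.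
  move=> [|k] // _; rewrite /collinear /corner /=.
  by case: i => [[]|] /= e; apply: (@absurd_le R); lra.
Qed.

Lemma on_path_A j q : on_arc (spoke_path None j) q ->
  (exists t, [/\ 0 <= t <= 1, q.1 = t * c j & q.2 = 1 - t]) \/
  (q.1 = c j /\ - c j <= q.2 <= 0).
Proof.
have h1 := c1 j.
move=> /on_path [] [t [/andP [t0 t1] ->]] /=; [left; exists t|right].
  by rewrite t0 t1; split=> //; ring.
have : 0 <= t * c j by apply: mulr_ge0; lra.
have : 0 <= (1 - t) * c j by apply: mulr_ge0; lra.
by lra.
Qed.

Lemma on_path_B j q : on_arc (spoke_path (Some false) j) q ->
  (exists t, [/\ 0 <= t <= 1, q.1 = t - 1 & q.2 = - (t * c j)]) \/
  (q.2 = - c j /\ 0 <= q.1 <= c j).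
Proof.
have h1 := c1 j.
move=> /on_path [] [t [/andP [t0 t1] ->]] /=; [left; exists t|right].
  by rewrite t0 t1; split=> //; ring.
have : 0 <= t * c j by apply: mulr_ge0; lra.
have : 0 <= (1 - t) * c j by apply: mulr_ge0; lra.
by lra.
Qed.

Lemma on_path_C j q : on_arc (spoke_path (Some true) j) q ->
  (exists t, [/\ 0 <= t <= 1, q.1 = m + 1 - t & q.2 = - (t * c j)]) \/
  (q.2 = - c j /\ c j <= q.1 <= m).
Proof.
have h1 := c1 j; have h2 := cm j.
move=> /on_path [] [t [/andP [t0 t1] ->]] /=; [left; exists t|right].
  by rewrite t0 t1; split=> //; ring.
have : 0 <= t * (m - c j) by apply: mulr_ge0; lra.
have : 0 <= (1 - t) * (m - c j) by apply: mulr_ge0; lra.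
by lra.
Qed.

Definition legal i j i' j' q :=
  [\/ i = i' /\ q = hub_pt i, j = j' /\ q = leaf_pt j |
      right_angle_crossing (spoke_path i j) (spoke_path i' j') q].

Lemma right_angle_crossingC p p' (q : point R) :
  right_angle_crossing p p' q -> right_angle_crossing p' p q.
Proof.
move=> [j [k [h1 h2 perp]]]; exists k, j; split=> //.
by move: perp; rewrite /perpendicular => <-; ring.
Qed.

Lemma legalC i j i' j' q : legal i j i' j' q -> legal i' j' i j q.
Proof.
case=> [[e1 e2]|[e1 e2]|h]; [apply: Or31|apply: Or32|apply: Or33].
- by rewrite -e1.
- by rewrite -e1.
- exact: right_angle_crossingC.
Qed.

(** On the two slanted sides the second coordinate forces equal parameters, and then the first one
    forces [c j = c j'] unless the parameter is 0, at the hub. *)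
Lemma paths_AA j j' q : j <> j' -> on_arc (spoke_path None j) q -> on_arc (spoke_path None j') q ->
  q = hub_pt None.
Proof.
move=> nj; have h1 := c1 j; have h1' := c1 j'.
case/on_path_A => [[t [t01 e1 e2]]|[e1 e2]]; case/on_path_A => [[s [s01 e3 e4]]|[e3 e4]].
- have st : s = t by lra.
  rewrite st in e3; case: (eqVneq t 0) => [t0|nt].
    by apply: point_eq => /=; rewrite ?e1 ?e2 t0 ?mul0r ?subr0.
  by case: nj; apply: cI; apply: (mulfI nt); rewrite -e1 -e3.
- have t1 : t = 1 by lra.
  by case: nj; apply: cI; rewrite -e3 e1 t1 mul1r.
- have s1 : s = 1 by lra.
  by case: nj; apply: cI; rewrite -e1 e3 s1 mul1r.
- by case: nj; apply: cI; rewrite -e1.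
Qed.

Lemma paths_BB j j' q : j <> j' -> on_arc (spoke_path (Some false) j) q ->
  on_arc (spoke_path (Some false) j') q -> q = hub_pt (Some false).
Proof.
move=> nj; have h1 := c1 j; have h1' := c1 j'.
case/on_path_B => [[t [t01 e1 e2]]|[e1 e2]]; case/on_path_B => [[s [s01 e3 e4]]|[e3 e4]].
- have st : s = t by lra.
  rewrite st in e4; case: (eqVneq t 0) => [t0|nt].
    by apply: point_eq => /=; rewrite ?e1 ?e2 t0 ?mul0r ?sub0r ?oppr0.
  by case: nj; apply: cI; apply: (mulfI nt); apply: oppr_inj; rewrite -e2 -e4.
- have t1 : t = 1 by lra.
  by case: nj; apply: cI; apply: oppr_inj; rewrite -e3 e2 t1 mul1r.
- have s1 : s = 1 by lra.
  by case: nj; apply: cI; apply: oppr_inj; rewrite -e1 e4 s1 mul1r.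
- by case: nj; apply: cI; apply: oppr_inj; rewrite -e1.
Qed.

Lemma paths_CC j j' q : j <> j' -> on_arc (spoke_path (Some true) j) q ->
  on_arc (spoke_path (Some true) j') q -> q = hub_pt (Some true).
Proof.
move=> nj; have h1 := c1 j; have h1' := c1 j'.
case/on_path_C => [[t [t01 e1 e2]]|[e1 e2]]; case/on_path_C => [[s [s01 e3 e4]]|[e3 e4]].
- have st : s = t by lra.
  rewrite st in e4; case: (eqVneq t 0) => [t0|nt].
    by apply: point_eq => /=; rewrite ?e1 ?e2 t0 ?mul0r ?subr0 ?oppr0.
  by case: nj; apply: cI; apply: (mulfI nt); apply: oppr_inj; rewrite -e2 -e4.
- have t1 : t = 1 by lra.
  by case: nj; apply: cI; apply: oppr_inj; rewrite -e3 e2 t1 mul1r.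
- have s1 : s = 1 by lra.
  by case: nj; apply: cI; apply: oppr_inj; rewrite -e1 e4 s1 mul1r.
- by case: nj; apply: cI; apply: oppr_inj; rewrite -e1.
Qed.

(** Vertical sides stay above the diagonal of leaves and horizontal sides from the left stay below
    it, so they meet only at a common leaf. *)
Lemma paths_AB j j' q : on_arc (spoke_path None j) q -> on_arc (spoke_path (Some false) j') q ->
  legal None j (Some false) j' q.
Proof.
have h1 := c1 j; have h1' := c1 j'.
case/on_path_A => [[t [t01 e1 e2]]|[e1 e2]]; case/on_path_B => [[s [s01 e3 e4]]|[e3 e4]].
- have sc : 0 <= s * c j' by apply: mulr_ge0; lra.
  have t1 : t = 1 by lra.
  by rewrite t1 mul1r in e1; apply: (@absurd_le R); lra.
- by apply: (@absurd_le R); lra.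
- by apply: (@absurd_le R); lra.
- by apply: Or32; split; [apply: cI; lra|apply: point_eq => /=; lra].
Qed.

Lemma paths_BC j j' q : on_arc (spoke_path (Some false) j) q -> on_arc (spoke_path (Some true) j') q ->
  legal (Some false) j (Some true) j' q.
Proof.
have h1 := c1 j; have h1' := c1 j'; have h2 := cm j; have h2' := cm j'.
case/on_path_B => [[t [t01 e1 e2]]|[e1 e2]]; case/on_path_C => [[s [s01 e3 e4]]|[e3 e4]];
  try by apply: (@absurd_le R); lra.
have ec : c j = c j' by lra.
by apply: Or32; split; [exact: cI|apply: point_eq => /=; lra].
Qed.

(** These are the only crossings of the drawing: if [c j' < c j], the vertical side above leaf [j]
    meets the horizontal side coming from the right to leaf [j'] at [(c j, - c j')]. *)
Lemma paths_AC j j' q : on_arc (spoke_path None j) q -> on_arc (spoke_path (Some true) j') q ->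
  legal None j (Some true) j' q.
Proof.
have h1 := c1 j; have h1' := c1 j'; have h2 := cm j; have h2' := cm j'.
case/on_path_A => [[t [t01 e1 e2]]|[e1 e2]]; case/on_path_C => [[s [s01 e3 e4]]|[e3 e4]].
- have sc : 0 <= s * c j' by apply: mulr_ge0; lra.
  have t1 : t = 1 by lra.
  by rewrite t1 mul1r in e1; apply: (@absurd_le R); lra.
- by apply: (@absurd_le R); lra.
- by apply: (@absurd_le R); lra.
have [ej|nj] := pselect (j = j').
  by apply: Or32; split=> //; apply: point_eq => /=; rewrite ?e1 // e3 ej.
have lt : c j' < c j.
  rewrite lt_neqAle; apply/andP; split; last by lra.
  by apply/eqP => /cI ejj; apply: nj.
apply: Or33; exists 1%N, 1%N; split.
- split=> //; exists (c j' / c j); split.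
    by rewrite divr_gt0 ?ltr_pdivrMr ?mul1r //; lra.
  rewrite /corner /segment_point /=; apply: point_eq => /=.
    by rewrite e1; ring.
  by rewrite e3 mulr0 add0r mulrN divfK //; apply/eqP => c0; lra.
- split=> //; exists ((m - c j) / (m - c j')); split.
    by rewrite divr_gt0 ?ltr_pdivrMr ?mul1r //; lra.
  have d0 : m - c j' != 0 by apply/eqP => c0; apply: (@absurd_le R); lra.
  rewrite /corner /segment_point /=; apply: point_eq => /=.
    have : (m - c j) / (m - c j') * (m - c j') = m - c j by rewrite divfK.
    by rewrite e1; set z := (_ / _); lra.
  by rewrite e3; ring.
- by rewrite /perpendicular /corner /=; ring.
Qed.

Lemma paths_legal i j i' j' q : (i, j) <> (i', j') -> on_arc (spoke_path i j) q ->
  on_arc (spoke_path i' j') q -> legal i j i' j' q.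
Proof.
have same : i = i' -> (i, j) <> (i', j') -> j <> j' by move=> <- h e; apply: h; rewrite e.
case: i i' same => [[]|] [[]|] same nij h1 h2.
- by apply: Or31; split=> //; apply: paths_CC h1 h2; apply: same.
- by apply/legalC/paths_BC.
- by apply/legalC/paths_AC.
- by apply: paths_BC.
- by apply: Or31; split=> //; apply: paths_BB h1 h2; apply: same.
- by apply/legalC/paths_AB.
- by apply: paths_AC.
- by apply: paths_AB.
- by apply: Or31; split=> //; apply: paths_AA h1 h2; apply: same.
Qed.

Lemma K3_in_class1 : in_class R 1 (K3 n).
Proof.
exists K3_pos, K3_arc; split; first exact: K3_pos_inj.
  move=> _ /edge_spoke [i [j ->]]; rewrite K3_arcE; split; first exact: path_polygonal.
  by exists (inl i), (inr j), [:: bend_pt i j].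
move=> _ _ /edge_spoke [i [j ->]] /edge_spoke [i' [j' ->]] nef q; rewrite !K3_arcE => h1 h2.
case: (@paths_legal i j i' j' q) => // [|[ei ->]|[ej ->]|]; last by right.
- by case=> ei ej; apply: nef; rewrite ei ej.
- by left; exists (inl i) => //; rewrite inE !in_spoke ei eqxx.
- by left; exists (inr j) => //; rewrite inE !in_spoke ej eqxx orbT.
Qed.

End OneBendDrawing.

(** * K(3, n) has no straight-line drawing for large n *)

Section Orientation.
Variable R : realType.
Implicit Types a b c p q : point R.

(** Twice the signed area of the triangle. *)
Definition orient a b c := (b.1 - a.1) * (c.2 - a.2) - (b.2 - a.2) * (c.1 - a.1).

Definition dot a b c d := (b.1 - a.1) * (d.1 - c.1) + (b.2 - a.2) * (d.2 - c.2).

Definition segments_meet a p b q := exists x, in_segment a p x /\ in_segment b q x.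

Definition on_ray a p q := exists2 k, 0 < k & q = segment_point a p k.

Lemma dot_self_gt0 a b : a <> b -> 0 < dot a b a b.
Proof.
move=> nab; rewrite lt_neqAle; apply/andP; split; last first.
  by rewrite /dot -!expr2 addr_ge0 // sqr_ge0.
rewrite eq_sym /dot -!expr2 paddr_eq0 ?sqr_ge0 // !sqrf_eq0 !subr_eq0.
by apply/negP => /andP [/eqP e1 /eqP e2]; apply/nab/point_eq.
Qed.

Lemma collinear_param a b p : a <> b -> orient a b p = 0 ->
  exists k, p = segment_point a b k.
Proof.
move=> nab o; have d := dot_self_gt0 nab.
have d0 : dot a b a b != 0 by rewrite gt_eqF.
(* The parameter of the orthogonal projection of [p] to the line through [a] and [b]. *)
exists (dot a b a p / dot a b a b).
apply: point_eq; apply: (mulfI d0); rewrite /segment_point /=.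
  have -> : dot a b a b * ((1 - dot a b a p / dot a b a b) * a.1 + dot a b a p / dot a b a b * b.1)
      = dot a b a b * a.1 + dot a b a p * (b.1 - a.1) by field.
  apply/eqP; rewrite -subr_eq0; apply/eqP.
  by transitivity (- (b.2 - a.2) * orient a b p); [rewrite /dot /orient; ring|rewrite o mulr0].
have -> : dot a b a b * ((1 - dot a b a p / dot a b a b) * a.2 + dot a b a p / dot a b a b * b.2)
    = dot a b a b * a.2 + dot a b a p * (b.2 - a.2) by field.
apply/eqP; rewrite -subr_eq0; apply/eqP.
by transitivity ((b.1 - a.1) * orient a b p); [rewrite /dot /orient; ring|rewrite o mulr0].
Qed.

Lemma segments_meetC a p b q : segments_meet a p b q -> segments_meet b q a p.
Proof. by move=> [x [h1 h2]]; exists x. Qed.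

(* Here [a p] and [b q] cross at the parameters [hq / (hq + ob)] and
   [hp / (hp + oa)], where [hp + oa = hq + ob]. *)
Lemma same_side_meet a b p q : 0 < orient a b p -> 0 < orient a b q ->
  0 < orient a p q -> 0 < orient b p q -> segments_meet a p b q.
Proof.
set hp := orient a b p; set hq := orient a b q; set oa := orient a p q.
set ob := orient b p q => hp0 hq0 oa0 ob0.
have e : hp + oa = hq + ob by rewrite /hp /hq /oa /ob /orient; ring.
have d0 : hq + ob != 0 by rewrite gt_eqF // addr_gt0.
have seg (k d : R) : 0 < k -> 0 < d -> 0 <= k / (k + d) <= 1.
  move=> k0 dd; have kd : 0 < k + d by rewrite addr_gt0.
  apply/andP; split; first by apply: divr_ge0; exact: ltW.
  by rewrite ler_pdivrMr // mul1r lerDl ltW.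
exists (segment_point a p (hq / (hq + ob))); split; first by exists (hq / (hq + ob)); split=> //; apply: seg.
exists (hp / (hp + oa)); split; first exact: seg.
rewrite e; apply: point_eq; apply: (mulfI d0); rewrite /segment_point /=.
  have -> : (hq + ob) * ((1 - hq / (hq + ob)) * a.1 + hq / (hq + ob) * p.1)
    = ob * a.1 + hq * p.1 by field.
  have -> : (hq + ob) * ((1 - hp / (hq + ob)) * b.1 + hp / (hq + ob) * q.1)
    = (hq + ob - hp) * b.1 + hp * q.1 by field.
  by rewrite /hp /hq /ob /orient; ring.
have -> : (hq + ob) * ((1 - hq / (hq + ob)) * a.2 + hq / (hq + ob) * p.2)
  = ob * a.2 + hq * p.2 by field.
have -> : (hq + ob) * ((1 - hp / (hq + ob)) * b.2 + hp / (hq + ob) * q.2)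
  = (hq + ob - hp) * b.2 + hp * q.2 by field.
by rewrite /hp /hq /ob /orient; ring.
Qed.

Lemma orientC a b c : orient b a c = - orient a b c.
Proof. by rewrite /orient; ring. Qed.
Lemma orientC' a b c : orient a c b = - orient a b c.
Proof. by rewrite /orient; ring. Qed.

Lemma same_side_ray a b p q : a <> p -> 0 < orient a b p -> 0 < orient a b q ->
  orient a p q = 0 -> on_ray a p q.
Proof.
move=> nap hp hq /(collinear_param nap) [k eq]; exists k => //.
have : orient a b q = k * orient a b p by rewrite eq /orient /segment_point /=; ring.
by move=> e; rewrite e pmulr_lgt0 in hq.
Qed.

(** If both orientations were positive, [a p] and [b q] would meet by [same_side_meet]; if both were
    negative, [a q] and [b p] would. The value zero would put [q] on a ray. *)
Lemma nested_same_side a b p q :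
  a <> p -> b <> p -> 0 < orient a b p -> 0 < orient a b q ->
  ~ on_ray a p q -> ~ on_ray b p q ->
  ~ segments_meet a p b q -> ~ segments_meet a q b p ->
  orient a p q * orient b p q < 0.
Proof.
move=> nap nbp hp hq ra rb m1 m2.
have a0 : orient a p q != 0 by apply/eqP => o; apply/ra/(same_side_ray nap hp hq o).
have b0 : orient b p q != 0.
  apply/eqP => o; apply: rb.
  have [k eq] := collinear_param nbp o; exists k => //.
  have e : orient a b q = k * orient a b p by rewrite eq /orient /segment_point /=; ring.
  by rewrite e pmulr_lgt0 in hq.
case: (ltgtP (orient a p q) 0) a0 => // oa _; case: (ltgtP (orient b p q) 0) b0 => // ob _.
- case: m2; apply: same_side_meet => //; rewrite orientC' oppr_gt0 //.
- by rewrite nmulr_rlt0.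
- by rewrite pmulr_rlt0.
- by case: m1; apply: same_side_meet.
Qed.

(** If [p] and [q] lie on the same side of [a] or of [b], they are on a common ray from it.
    Otherwise both [a] and [b] separate them, and two of the segments overlap between [a] and
    [b]. *)
Lemma collinear_hubs a b p q : a <> b -> orient a b p = 0 -> orient a b q = 0 ->
  a <> p -> a <> q -> b <> p -> b <> q ->
  [\/ on_ray a p q, on_ray b p q, segments_meet a p b q | segments_meet a q b p].
Proof.
move=> nab /(collinear_param nab) [k ek] /(collinear_param nab) [l el] nap naq nbp nbq.
have sp0 : segment_point a b 0 = a by rewrite /segment_point; apply: point_eq => /=; ring.
have sp1 : segment_point a b 1 = b by rewrite /segment_point; apply: point_eq => /=; ring.
have k0 : k != 0 by apply/eqP => h; apply: nap; rewrite ek h sp0.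
have l0 : l != 0 by apply/eqP => h; apply: naq; rewrite el h sp0.
have k1 : 1 - k != 0 by rewrite subr_eq0; apply/eqP => h; apply: nbp; rewrite ek -h sp1.
have l1 : 1 - l != 0 by rewrite subr_eq0; apply/eqP => h; apply: nbq; rewrite el -h sp1.
have seg u v w : u <= w <= v -> u != v ->
    in_segment (segment_point a b u) (segment_point a b v) (segment_point a b w).
  move=> uwv uv; have vu : 0 < v - u by rewrite subr_gt0 lt_neqAle uv; lra.
  have vu0 : v - u != 0 by rewrite gt_eqF.
  exists ((w - u) / (v - u)); split.
    by rewrite divr_ge0 ?ler_pdivrMr ?mul1r; lra.
  by apply: point_eq; rewrite /segment_point /=; field.
have seg' u v w : u <= w <= v -> u != v ->
    in_segment (segment_point a b v) (segment_point a b u) (segment_point a b w).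
  by move=> h1 h2; apply: in_segmentC; apply: seg.
have raya : 0 < l / k -> on_ray a p q.
  move=> lk; exists (l / k) => //; rewrite ek el.
  by apply: point_eq; rewrite /segment_point /=; field.
have rayb : 0 < (1 - l) / (1 - k) -> on_ray b p q.
  move=> lk; exists ((1 - l) / (1 - k)) => //; rewrite ek el.
  by apply: point_eq; rewrite /segment_point /=; field.
case: (ltgtP k 0) k0 => // kk _; case: (ltgtP l 0) l0 => // ll _.
- by apply: Or42; apply: rayb; rewrite divr_gt0 //; lra.
- case: (ltgtP l 1) => l11.
  + by apply: Or42; apply: rayb; rewrite divr_gt0 //; lra.
  + apply: Or44; exists a; split.
      by have := @seg 0 l 0; rewrite sp0 -el; apply; [lra|rewrite lt_eqF //; lra].
    by have := @seg' k 1 0; rewrite sp0 sp1 -ek; apply; [lra|rewrite lt_eqF //; lra].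
  + by rewrite l11 subrr eqxx in l1.
- case: (ltgtP k 1) => k11.
  + by apply: Or42; apply: rayb; rewrite divr_gt0 //; lra.
  + apply: Or43; exists a; split.
      by have := @seg 0 k 0; rewrite sp0 -ek; apply; [lra|rewrite lt_eqF //; lra].
    by have := @seg' l 1 0; rewrite sp0 sp1 -el; apply; [lra|rewrite lt_eqF //; lra].
  + by rewrite k11 subrr eqxx in k1.
- by apply: Or41; apply: raya; rewrite divr_gt0.
Qed.

(** The sign of the orientation, encoded in a finite type for the pigeonhole argument. *)
Definition side a b p := (0 < orient a b p, orient a b p < 0).

Lemma nested a b p q : a <> b -> a <> p -> a <> q -> b <> p -> b <> q ->
  side a b p = side a b q -> ~ on_ray a p q -> ~ on_ray b p q ->
  ~ segments_meet a p b q -> ~ segments_meet a q b p ->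
  orient a p q * orient b p q < 0.
Proof.
move=> nab nap naq nbp nbq; rewrite /side => -[s1 s2] ra rb m1 m2.
case: (ltgtP (orient a b p) 0) s1 s2 => hp /esym s1 /esym s2.
- rewrite mulrC; apply: nested_same_side => //.
  + by rewrite orientC oppr_gt0.
  + by rewrite orientC oppr_gt0.
  + by move=> /segments_meetC.
  + by move=> /segments_meetC.
- exact: nested_same_side.
have hq : orient a b q = 0 by move: s1 s2; case: ltgtP.
by case: (collinear_hubs nab hp hq nap naq nbp nbq).
Qed.

End Orientation.

(** * Straight-line drawings of K(3, n) *)

Section Straight.
Variables (R : realType) (n : nat) (pos : vertex (K3 n) -> point R)
  (arc : {set vertex (K3 n)} -> seq (point R)).
Hypothesis pos_inj : injective pos.
Hypothesis arcP : forall e, e \in edges (K3 n) -> polygonal_arc (arc e) /\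
  exists (u v : vertex (K3 n)) (bends : seq (point R)),
    [/\ e = [set u; v], arc e = pos u :: rcons bends (pos v) & (size bends <= 0)%N].
Hypothesis arc_cross : forall e f, e \in edges (K3 n) -> f \in edges (K3 n) -> e <> f ->
  forall x, on_arc (arc e) x -> on_arc (arc f) x ->
  (exists2 w, w \in e :&: f & x = pos w) \/ right_angle_crossing (arc e) (arc f) x.

Let H i := pos (inl i).
Let P j := pos (inr j).

Let HP i j : H i <> P j. Proof. by move=> /pos_inj. Qed.
Let HH i i' : i <> i' -> H i <> H i'. Proof. by move=> ni /pos_inj []. Qed.

Let arcE i j : arc (spoke i j) = [:: H i; P j] \/ arc (spoke i j) = [:: P j; H i].
Proof.
have [_ [u [v [bs [e -> sz]]]]] := arcP (spoke_edge i j).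
case: bs sz => //= _.
have hu : u \in spoke i j by rewrite e !inE eqxx.
have hv : v \in spoke i j by rewrite e !inE eqxx orbT.
have hi : inl i \in [set u; v] by rewrite -e in_spoke eqxx.
have hj : inr j \in [set u; v] by rewrite -e in_spoke eqxx orbT.
move: hu hv hi hj; rewrite !in_spoke !inE.
by case: u {e} => [i'|j']; case: v => [i2|j2] //=; rewrite ?orbF => /eqP [->] /eqP [->]; [left|right].
Qed.

Let on_arcE i j x : in_segment (H i) (P j) x -> on_arc (arc (spoke i j)) x.
Proof. by case: (arcE i j) => -> s; exists 0%N; split=> //=; apply: in_segmentC. Qed.

Let inside_arc i j k x : inside_side (arc (spoke i j)) k x ->
  x <> H i /\ exists2 s, s != 0 &
    forall c d, dot (corner (arc (spoke i j)) k) (corner (arc (spoke i j)) k.+1) c d =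
      s * dot (H i) (P j) c d.
Proof.
case: (arcE i j) => -> [sk]; case: k sk => //= _ op.
  have [h _] := open_segment_ends (@HP i j) op; split=> //.
  by exists 1; rewrite ?oner_eq0 // => c d; rewrite mul1r.
have [_ h] := open_segment_ends (nesym (@HP i j)) op; split=> //.
exists (-1); rewrite ?oppr_eq0 ?oner_eq0 // => c d; rewrite /dot /corner /=; ring.
Qed.

Let dotC (a b c d : point R) : dot a b c d = dot c d a b.
Proof. by rewrite /dot; ring. Qed.

Let common i j i' j' x : (i, j) <> (i', j') -> in_segment (H i) (P j) x ->
  in_segment (H i') (P j') x ->
  [\/ i = i' /\ x = H i, j = j' /\ x = P j |
      [/\ dot (H i) (P j) (H i') (P j') = 0, x <> H i & x <> H i']].
Proof.
move=> nij s1 s2; have ne : spoke i j <> spoke i' j' by move=> /spoke_inj [e1 e2]; apply: nij; rewrite e1 e2.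
case: (arc_cross (spoke_edge i j) (spoke_edge i' j') ne (on_arcE s1) (on_arcE s2)).
  move=> [w]; rewrite inE !in_spoke => /andP [/orP [] /eqP -> /orP [] /eqP // [ee] ->].
    by apply: Or31.
  by apply: Or32.
move=> [k [k' [h1 h2 perp]]]; apply: Or33.
have [n1 [s s0 d1]] := inside_arc h1; have [n2 [s' s'0 d2]] := inside_arc h2.
split=> //; apply: (mulfI (mulf_neq0 s0 s'0)).
by rewrite mulr0 -mulrA [s' * _]mulrC mulrA -d1 mulrC dotC; rewrite -d2 dotC.
Qed.

(** Otherwise the nearer leaf would lie on the edge to the farther one, although the two edges are
    parallel and so cannot cross at a right angle. *)
Let no_ray i j j' : j <> j' -> ~ on_ray (H i) (P j) (P j').
Proof.
move=> nj [k k0 e]; have nij : (i, j) <> (i, j') by case.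
have nj' : (i, j') <> (i, j) by case=> /esym.
have endP h : in_segment (H i) (P h) (P h).
  by exists 1; rewrite lexx ler01; split=> //; apply: point_eq; rewrite /segment_point /=; ring.
have dk : dot (H i) (P j) (H i) (P j') = k * dot (H i) (P j) (H i) (P j).
  by rewrite e /dot /segment_point /=; ring.
have dn : dot (H i) (P j) (H i) (P j') <> 0.
  by apply/eqP; rewrite dk mulf_neq0 ?gt_eqF // dot_self_gt0.
have [k1|k1] := lerP k 1.
  have s : in_segment (H i) (P j) (P j') by exists k; rewrite ltW.
  by case: (common nij s (endP j')) => [[_ /esym/HP]|[]|[]].
have s : in_segment (H i) (P j') (P j).
  have kn : k != 0 by rewrite gt_eqF.
  exists (k^-1); split; first by rewrite invr_ge0 invf_le1 ?ltW //.
  by rewrite e; apply: point_eq; rewrite /segment_point /=; field.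
by case: (common nij (endP j) s) => [[_ /esym/HP]|[]|[]].
Qed.

Let meet_perp i j i' j' : i <> i' -> j <> j' ->
  segments_meet (H i) (P j) (H i') (P j') -> exists x,
  [/\ in_segment (H i) (P j) x, in_segment (H i') (P j') x, x <> H i' &
      dot (H i) (P j) (H i') (P j') = 0].
Proof.
move=> ni nj [x [s1 s2]]; exists x.
have nij : (i, j) <> (i', j') by case.
by case: (common nij s1 s2) => [[]|[]|[]].
Qed.

(** Both crossing points are the foot of the perpendicular from [H i'] to the line of the segment,
    so they coincide; two edges from [H i'] would then overlap. *)
Let meet_uniq i j i' j1 j2 : i <> i' -> j <> j1 -> j <> j2 ->
  segments_meet (H i) (P j) (H i') (P j1) -> segments_meet (H i) (P j) (H i') (P j2) ->
  j1 = j2.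
Proof.
move=> ni n1 n2 /(meet_perp ni n1) [x [sx tx nx dx]] /(meet_perp ni n2) [y [sy ty ny dy]].
have d0 := dot_self_gt0 (@HP i j).
have exy : x = y.
  have [r [_ ex]] := sx; have [s [_ ey]] := sy.
  have [r' [_ ex']] := tx; have [s' [_ ey']] := ty.
  have e1 : dot (H i) (P j) (H i') x = 0.
    by transitivity (r' * dot (H i) (P j) (H i') (P j1)); [rewrite ex' /dot /segment_point /=; ring|rewrite dx mulr0].
  have e2 : dot (H i) (P j) (H i') y = 0.
    by transitivity (s' * dot (H i) (P j) (H i') (P j2)); [rewrite ey' /dot /segment_point /=; ring|rewrite dy mulr0].
  have e3 : (r - s) * dot (H i) (P j) (H i) (P j) = 0.
    transitivity (dot (H i) (P j) (H i') x - dot (H i) (P j) (H i') y); last by rewrite e1 e2 subrr.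
    by rewrite ex ey /dot /segment_point /=; ring.
  have rs : r = s.
    by apply/eqP; rewrite -subr_eq0; move/eqP: e3; rewrite mulf_eq0 (gt_eqF d0) orbF.
  by rewrite ex ey rs.
apply: contrapT => nj; have nij : (i', j1) <> (i', j2) by case.
rewrite -exy in ty; case: (common nij tx ty) => [[]|[]|[d _ _]] //.
have [r [_ ex]] := tx; have [s [_ ey]] := ty.
have := dot_self_gt0 (nesym nx).
suff -> : dot (H i') x (H i') x = r * s * dot (H i') (P j1) (H i') (P j2).
  by rewrite d mulr0 ltxx.
by rewrite {2}ey {1}ex /dot /segment_point /=; ring.
Qed.

Let far j j' := forall i i', i <> i' -> ~ segments_meet (H i) (P j) (H i') (P j').

Let class j := (side (H None) (H (Some true)) (P j),
  side (H None) (H (Some false)) (P j), side (H (Some true)) (H (Some false)) (P j)).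

(** By [nested], three numbers would have pairwise negative products. *)
Let far_class j j' : j <> j' -> class j = class j' -> ~ far j j'.
Proof.
move=> nj [] cl1 cl1' cl2 cl2' cl3 cl3' fr.
have fr' i i' : i <> i' -> ~ segments_meet (H i) (P j') (H i') (P j).
  by move=> ni /segments_meetC; apply: fr; apply: nesym.
have key i i' : i <> i' -> side (H i) (H i') (P j) = side (H i) (H i') (P j') ->
    orient (H i) (P j) (P j') * orient (H i') (P j) (P j') < 0.
  move=> ni sd; apply: nested => //; [exact: HH|exact: no_ray|exact: no_ray|exact: fr|exact: fr'].
have k1 : orient (H None) (P j) (P j') * orient (H (Some true)) (P j) (P j') < 0.
  by apply: key => //; rewrite /side cl1 cl1'.
have k2 : orient (H None) (P j) (P j') * orient (H (Some false)) (P j) (P j') < 0.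
  by apply: key => //; rewrite /side cl2 cl2'.
have k3 : orient (H (Some true)) (P j) (P j') * orient (H (Some false)) (P j) (P j') < 0.
  by apply: key => //; rewrite /side cl3 cl3'.
move: k1 k2 k3; set a := orient _ _ _; set b := orient _ _ _; set c := orient _ _ _ => k1 k2 k3.
have : 0 < (a * b) * (a * c) by rewrite nmulr_rgt0.
rewrite mulrACA ltNge => /negP; apply.
by apply: mulr_ge0_le0; [rewrite -expr2 sqr_ge0|exact: ltW].
Qed.

(** There are 64 classes with at most 10 leaves each: for a fixed leaf [j] of a class, each other
    leaf yields by [far_class] a crossing on an edge of [j], and by [meet_uniq] the pair of hubs
    determines that leaf; there are 9 pairs of hubs. *)
Lemma straight_small : (n <= 640)%N.
Proof.
pose C (k : (bool * bool) * (bool * bool) * (bool * bool)) := [set j | class j == k].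
have small k : (#|C k| <= 10)%N.
  have [->|[j jC]] := set_0Vmem (C k); first by rewrite cards0.
  rewrite (cardsD1 j) jC add1n ltnS.
  have -> : 9%N = #|[set: option bool * option bool]|.
    by rewrite cardsT card_prod !card_option card_bool.
  apply: (@leq_card_witness _ _ _ _ (fun j' ii => [/\ j <> j', ii.1 <> ii.2 &
     segments_meet (H ii.1) (P j) (H ii.2) (P j')])).
    move=> j'; rewrite !inE => /andP [/eqP nj /eqP cj']; move: jC; rewrite inE => /eqP cj.
    have := @far_class j j' (nesym nj); rewrite cj cj' => /(_ erefl).
    move=> /existsNP [i /existsNP [i' /not_implyP [ni /contrapT m]]].
    by exists (i, i'); rewrite ?inE //; split=> //; apply: nesym.
  move=> j1 j2 [i i'] [/= n1 ni m1] [/= n2 _ m2]; exact: meet_uniq ni n1 n2 m1 m2.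
have : (\sum_(j : 'I_n) 1 <= \sum_(k : (bool * bool) * (bool * bool) * (bool * bool)) 10)%N.
  rewrite (partition_big class predT) //=; apply: leq_sum => k _.
  apply: leq_trans (small k); rewrite -sum1_card big_mkcond /= [leqRHS]big_mkcond /=.
  by apply: leq_sum => j _; rewrite inE.
by rewrite sum1_card card_ord sum_nat_const !card_prod !card_bool.
Qed.

End Straight.

Lemma K3_not_class0 (R : realType) n : (640 < n)%N -> ~ in_class R 0 (K3 n).
Proof.
move=> lt [pos [arc [pos_inj arcP cross]]].
by have := straight_small pos_inj arcP cross; rewrite leqNgt lt.
Qed.

Lemma isomorphic_card G H : isomorphic G H -> #|vertex G| = #|vertex H|.
Proof. by move=> [f [bij _]]; exact: bij_eq_card bij. Qed.

Theorem theorem1 (R : realType) :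
  (exists C : R, 0 < C /\
     forall G : sgraph, in_class R 1 G ->
       #|edges G|%:R <= C * #|vertex G|%:R) /\
  (exists G : nat -> sgraph,
     (forall i j : nat, i <> j -> ~ isomorphic (G i) (G j)) /\
     (forall i : nat, in_class R 1 (G i) /\ ~ in_class R 0 (G i))).
Proof.
split.
  exists 324%:R; split=> // G /one_bend_card le.
  by rewrite -natrM ler_nat.
(* The shift passes the bound 640 of [straight_small]; the graphs are told apart by their numbers of
   vertices. *)
exists (fun i => K3 (641 + i)); split=> [i j nij /isomorphic_card|i].
  by rewrite !card_K3 => /addnI /addnI.
by split; [exact: K3_in_class1|apply: K3_not_class0; rewrite ltn_addr].
Qed.
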